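(* Let $\hbar\in\mathbb{C}^\times$ and let $\omega_0^\hbar$ be a local frame of $\mathcal{L}$ (so $\omega_0^\hbar\in H^{2,0}(X_u)$ fiberwise) satisfying the $\hbar$-deformed Picard--Fuchs equation $$\hbar^3\nabla_u^3\omega_0^\hbar=-b_2\,\hbar^2\nabla_u^2\omega_0^\hbar-b_1\,\hbar\nabla_u\omega_0^\hbar-b_0\,\omega_0^\hbar$$ with coefficient functions $b_i=b_i(u)$, $i=0,1,2$. Let $e^{-K}=h(\omega_0^\hbar,\omega_0^\hbar)$, $K_u=\partial_uK$, $G_{u\bar u}=\partial_u\partial_{\bar u}K$, $G^{u\bar u}=G_{u\bar u}^{-1}$ and $\Gamma_{uu}^u=G^{u\bar u}\partial_uG_{u\bar u}$. Then: (1) $\displaystyle \Gamma_{uu}^u-K_u=-\frac{1}{3\hbar}b_2$; (2) $\displaystyle \partial_uK_u=\frac12K_u^2-\frac{1}{3\hbar}b_2K_u-\frac{1}{9\hbar^2}b_2^2-\frac{1}{6\hbar}\partial_ub_2+\frac{1}{2\hbar^2}b_1$; (3) $\displaystyle \hbar^2\,\partial_u^2b_2+2b_2\,\hbar\,\partial_ub_2-3\hbar\,\partial_ub_1+\frac49b_2^3-2b_1b_2+6b_0=0$.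
   Context: Let $n\ge1$, let $M\cong U\perp E_8\perp E_8\perp\langle-2n\rangle$ (rank 19, $U$ the hyperbolic plane, $E_8$ negative definite), $\mathcal{B}=\mathbb{CP}^1-\{0,1,\infty\}$, and let $\pi:\mathcal{X}\to\mathcal{B}$ be a complete family of $M$-polarized K3 surfaces with fibers $X_u$ (complete: $T_u\mathcal{B}\cong H^{1,1}(X_u)/j_u(M)_{\mathbb{C}}$ via deformations, with $j_u:M\hookrightarrow\mathrm{Pic}(X_u)$ the polarization). $T(X_u)=M^\perp\subset H^2(X_u,\mathbb{Z})$ is a Hodge substructure of rank 3 with one-dimensional Hodge components, written $H^{2,0},H^{1,1},H^{0,2}$ (instead of $T^{p,q}$). $\mathcal{H}$ denotes the resulting rank 3 bundle on $\mathcal{B}$ with fibers $T(X_u)\otimes\mathbb{C}$, flat Gauss--Manin connection $\nabla$, and Hodge filtration satisfying Griffiths transversality; $\mathcal{L}=F^2$ is the holomorphic line bundle with fibers $H^{2,0}(X_u)$. Polarization: $Q(\alpha,\beta)=-\int_{X_u}\alpha\wedge\beta$; Weil operator $W|_{H^{p,q}}=i^{p-q}$; Hodge metric $h(\alpha,\beta)=Q(W\alpha,\bar\beta)$, so $h(\omega_0^\hbar,\omega_0^\hbar)=\int_{X_u}\omega_0^\hbar\wedge\overline{\omega_0^\hbar}$. $u$ is a local coordinate on $\mathcal{B}$ and $\nabla_u=\nabla_{\partial/\partial u}$. The functions $b_i$ are holomorphic in $u$ (rational functions on $\mathcal{B}$). *)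

(* Defs.v *)
From HB Require Import structures.
From mathcomp Require Import all_boot all_order all_algebra.
From mathcomp Require Import all_classical all_reals all_analysis.
From mathcomp Require Import complex.

Set Implicit Arguments.
Unset Strict Implicit.
Unset Printing Implicit Defensive.

Import Order.TTheory GRing.Theory Num.Theory numFieldNormedType.Exports.

Local Open Scope classical_set_scope.
Local Open Scope ring_scope.
Local Open Scope complex_scope.

(* The library puts the norm topology on the sort of a numClosedFieldType, but
   unification does not find it on R[i] itself; it is copied here, so that
   [derivable f z 1] and [derive1 f z] are complex differentiability and the
   complex derivative for functions on R[i]. *)
HB.instance Definition _ (R : rcfType) := GRing.ComAlgebra.copy R[i] (R[i]^o).
HB.instance Definition _ (R : rcfType) := Vector.copy R[i] (R[i]^o).
HB.instance Definition _ (R : rcfType) := NormedModule.copy R[i] (R[i]^o).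

(** * Lattices, given by Gram matrices *)

Definition osum (m n : nat) (A : 'M[int]_m) (B : 'M[int]_n) : 'M[int]_(m + n) :=
  block_mx A 0 0 B.

Definition U_gram : 'M[int]_2 := \matrix_(i, j) (i != j)%:R.

(* Dynkin diagram of E8: the chain 0 - 1 - ... - 6, with 7 attached to 4. *)
Definition E8_edge (i j : nat) : bool :=
  ((j == i.+1)%N && (j < 7)%N) || ((i == 4)%N && (j == 7)%N).

Definition E8_gram : 'M[int]_8 :=
  \matrix_(i, j) (if i == j then - 2
                  else if E8_edge i j || E8_edge j i then 1 else 0).

Definition M_gram (n : nat) : 'M[int]_19 :=
  osum U_gram (osum E8_gram (osum E8_gram (- (2 * n)%N%:Z)%:M)).

Definition K3_gram : 'M[int]_22 :=
  osum U_gram (osum U_gram (osum U_gram (osum E8_gram E8_gram))).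

Section Complex.
Variable R : realType.
Local Notation C := R[i].

(** * Complex calculus *)

Definition holomorphic_on (V : normedModType C) (D : set C) (f : C -> V) : Prop :=
  forall z, D z -> derivable f z 1.

Definition partial_re (f : C -> C) (z : C) : C :=
  lim ((h%:C)^-1 * (f (z + h%:C) - f z) @[h --> (0 : R)^']).

Definition partial_im (f : C -> C) (z : C) : C :=
  lim ((h%:C)^-1 * (f (z + 'i * h%:C) - f z) @[h --> (0 : R)^']).

(* Wirtinger operators d/du and d/d(ubar). *)
Definition dz (f : C -> C) (z : C) : C :=
  2^-1 * (partial_re f z - 'i * partial_im f z).

Definition dzbar (f : C -> C) (z : C) : C :=
  2^-1 * (partial_re f z + 'i * partial_im f z).

(** * Linear algebra on the second cohomology: vectors are rows, and a subspace
    is the row space of a matrix *)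

Definition ZtoC (m n : nat) (A : 'M[int]_(m, n)) : 'M[C]_(m, n) :=
  map_mx (intr : int -> C) A.

Definition conj_mx (m n : nat) (A : 'M[C]_(m, n)) : 'M[C]_(m, n) :=
  map_mx (@conjc R) A.

Definition cup (x y : 'rV[C]_22) : C := (x *m ZtoC K3_gram *m y^T) 0 0.

Definition isometry_mx (g : 'M[int]_22) : Prop := g *m K3_gram *m g^T = K3_gram.

Definition primitive_mx (m n : nat) (A : 'M[int]_(m, n)) : Prop :=
  forall (k : int) (x : 'rV[int]_n) (y : 'rV[int]_m),
    k != 0 -> k *: x = y *m A -> exists y' : 'rV[int]_m, x = y' *m A.

Definition holomorphic_subbundle (r : nat) (D : set C) (S : C -> 'M[C]_22) : Prop :=
  forall z, D z -> exists (V : set C) (A : C -> 'M[C]_(r, 22)),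
    [/\ open V, V z, V `<=` D, holomorphic_on V A
      & forall w, V w -> row_free (A w) && (A w == S w)%MS].

Definition locally_constant (T : Type) (D : set C) (f : C -> T) : Prop :=
  forall z, D z -> \forall w \near z, f w = f z.

(* CP^1 - {0, 1, oo} in its affine coordinate. *)
Definition base : set C := [set t | t != 0 /\ t != 1].

(** * Families of M-polarized K3 surfaces over [base]

    A family enters through its variation of Hodge structure on H^2.  The local
    system with fibers H^2(X_t, Z) is glued from flat markings, i.e. flat
    isometries with the K3 lattice, indexed by [idx] and defined on the open
    sets [dom i]; a class with coordinates x in the marking i has coordinates
    [x *m trans i j t] in the marking j.  [pol i t] is the matrix of
    j_t : M -> Pic(X_t), and Pic(X_t) is the lattice of integral classes of
    type (1,1). *)
Record K3_family (n : nat) := K3Family {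
  idx : Type;
  dom : idx -> set C;
  trans : idx -> idx -> C -> 'M[int]_22;
  pol : idx -> C -> 'M[int]_(19, 22);
  H20 : idx -> C -> 'M[C]_22;
  H11 : idx -> C -> 'M[C]_22;
  H02 : idx -> C -> 'M[C]_22;

  dom_open : forall i, open (dom i);
  dom_cover : \bigcup_(i in [set: idx]) dom i = base;
  trans_const : forall i j, locally_constant (dom i `&` dom j) (trans i j);
  trans_isometry : forall i j t, dom i t -> dom j t -> isometry_mx (trans i j t);
  trans_cocycle : forall i j k t, dom i t -> dom j t -> dom k t ->
    trans i j t *m trans j k t = trans i k t;

  pol_const : forall i, locally_constant (dom i) (pol i);
  pol_glue : forall i j t, dom i t -> dom j t -> pol j t = pol i t *m trans i j t;
  pol_isometric : forall i t, dom i t ->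
    pol i t *m K3_gram *m (pol i t)^T = M_gram n;
  pol_primitive : forall i t, dom i t -> primitive_mx (pol i t);
  pol_Pic : forall i t, dom i t -> (ZtoC (pol i t) <= H11 i t)%MS;

  H20_glue : forall i j t, dom i t -> dom j t ->
    (H20 j t == H20 i t *m ZtoC (trans i j t))%MS;
  H11_glue : forall i j t, dom i t -> dom j t ->
    (H11 j t == H11 i t *m ZtoC (trans i j t))%MS;
  H02_glue : forall i j t, dom i t -> dom j t ->
    (H02 j t == H02 i t *m ZtoC (trans i j t))%MS;

  h20 : forall i t, dom i t -> \rank (H20 i t) = 1%N;
  h11 : forall i t, dom i t -> \rank (H11 i t) = 20%N;
  h02 : forall i t, dom i t -> \rank (H02 i t) = 1%N;
  Hodge_decomposition : forall i t, dom i t ->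
    row_full (H20 i t + H11 i t + H02 i t)%MS;
  H20_conj : forall i t, dom i t -> (conj_mx (H20 i t) == H02 i t)%MS;
  H11_conj : forall i t, dom i t -> (conj_mx (H11 i t) == H11 i t)%MS;
  cup_20_20 : forall i t (x y : 'rV_22), dom i t ->
    (x <= H20 i t)%MS -> (y <= H20 i t)%MS -> cup x y = 0;
  cup_20_11 : forall i t (x y : 'rV_22), dom i t ->
    (x <= H20 i t)%MS -> (y <= H11 i t)%MS -> cup x y = 0;
  cup_20_02 : forall i t (x : 'rV_22), dom i t ->
    (x <= H20 i t)%MS -> x != 0 -> 0 < cup x (conj_mx x);

  F2_holomorphic : forall i, holomorphic_subbundle 1 (dom i) (H20 i);
  F1_holomorphic : forall i,
    holomorphic_subbundle 21 (dom i) (fun t => H20 i t + H11 i t)%MS;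
  Griffiths : forall i (V : set C) (s : C -> 'rV[C]_22),
    open V -> V `<=` dom i -> holomorphic_on V s ->
    (forall t, V t -> (s t <= H20 i t)%MS) ->
    forall t, V t -> (derive1 s t <= H20 i t + H11 i t)%MS
}.

Section Family.
Variables (n : nat) (X : K3_family n).

(* T(X_t) tensor C, the orthogonal complement of j_t(M). *)
Definition transc (i : idx X) (t : C) : 'M[C]_22 :=
  kermx (ZtoC K3_gram *m (ZtoC (pol i t))^T).

(* The fiber of the line bundle L = F^2 of the rank 3 bundle with fibers
   [transc]. *)
Definition Lfiber (i : idx X) (t : C) : 'M[C]_22 := (transc i t :&: H20 i t)%MS.

(* T_t(base) = C.  For a local frame s of F^2, a tangent vector v is sent by
   deformation to the class of v * (ds/dt) in
   F^1 / (F^2 + j(M)_C) = H^{1,1} / j(M)_C; this map is required to be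
   bijective.  Changing s only rescales it. *)
Definition complete : Prop :=
  forall (i : idx X) (V : set C) (s : C -> 'rV[C]_22) (t : C),
    open V -> V `<=` dom i -> holomorphic_on V s ->
    (forall w, V w -> (s w <= H20 i w)%MS /\ s w != 0) -> V t ->
    forall eta : 'rV[C]_22, (eta <= H11 i t)%MS ->
      exists! v : C, (eta - v *: derive1 s t <= H20 i t + ZtoC (pol i t))%MS.

Definition polQ (x y : 'rV[C]_22) : C := - cup x y.

Definition weil (i : idx X) (t : C) (x : 'rV[C]_22) : 'rV[C]_22 :=
  'i ^+ 2 *: (x *m proj_mx (H20 i t) (H11 i t + H02 i t)%MS)
  + 'i ^+ 0 *: (x *m proj_mx (H11 i t) (H20 i t + H02 i t)%MS)
  + 'i ^- 2 *: (x *m proj_mx (H02 i t) (H20 i t + H11 i t)%MS).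

Definition hodge_metric (i : idx X) (t : C) (x y : 'rV[C]_22) : C :=
  polQ (weil i t x) (conj_mx y).

(** * Local coordinates and local sections

    A local coordinate u on [base] is given by the point [phi u] with
    coordinate u, for u in [D].  A section over [phi @` D] is given by its
    coordinates [s i u] in each marking i with [phi u] in [dom i]; the values
    of [s i] elsewhere are irrelevant. *)
Definition local_coordinate (D : set C) (phi : C -> C) : Prop :=
  [/\ open D, holomorphic_on D phi, (forall u, D u -> derive1 phi u != 0),
      {in D &, injective phi} & forall u, D u -> base (phi u)].

Definition cdom (D : set C) (phi : C -> C) (i : idx X) : set C :=
  [set u | D u /\ dom i (phi u)].

Definition local_frame_L (D : set C) (phi : C -> C)
    (s : idx X -> C -> 'rV[C]_22) : Prop :=
  [/\ forall i j u, cdom D phi i u -> cdom D phi j u ->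
        s j u = s i u *m ZtoC (trans i j (phi u)),
      forall i, holomorphic_on (cdom D phi i) (s i)
    & forall i u, cdom D phi i u -> (s i u <= Lfiber i (phi u))%MS /\ s i u != 0].

(* The Gauss-Manin connection is differentiation in a flat marking. *)
Definition nabla (s : idx X -> C -> 'rV[C]_22) : idx X -> C -> 'rV[C]_22 :=
  fun i => derive1 (s i).

(* The derivatives that occur are required to exist, so that [nabla] never takes
   a default value; for holomorphic s this is automatic. *)
Definition Picard_Fuchs (D : set C) (phi : C -> C) (hbar : C) (b0 b1 b2 : C -> C)
    (s : idx X -> C -> 'rV[C]_22) : Prop :=
  forall i,
    [/\ holomorphic_on (cdom D phi i) (s i),
        holomorphic_on (cdom D phi i) (nabla s i),
        holomorphic_on (cdom D phi i) (nabla (nabla s) i)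
      & forall u, cdom D phi i u ->
          hbar ^+ 3 *: nabla (nabla (nabla s)) i u =
            - (b2 u * hbar ^+ 2) *: nabla (nabla s) i u
            - (b1 u * hbar) *: nabla s i u
            - b0 u *: s i u].

End Family.
End Complex.

(* Main.v *)
(* Write B for the cup product form, s for the frame and ' for nabla_u.  Since
   B(s,s) = 0, the Yukawa coupling Y = B(s,s'') = - B(s',s') satisfies a first
   order equation, and B(s',s''), B(s'',s'') are expressed through Y, b_1, b_2 by
   pairing the Picard-Fuchs equation with s and s'.  Differentiating
   B(s'',s'') = Y (p' + p^2 - b_1 / hbar^2), p = b_2 / (3 hbar), gives (3).  The
   space T(X_u) has rank 3 and, by completeness, basis s, s', conj s.  Pairing
   s'' = al s + be s' + ga conj s with conj s and conj s' expresses the first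
   derivatives of K_u and of the metric, where e^-K = B(s, conj s), through al
   and be; pairing it with s, s' and s'' determines al, be and ga, whence (1) and
   (2). *)
Require Import Defs.
From mathcomp Require Import all_boot all_order all_algebra.
From mathcomp Require Import all_classical all_reals all_analysis.
From mathcomp Require Import complex ring.
Import Order.TTheory GRing.Theory Num.Theory numFieldNormedType.Exports.
Local Open Scope classical_set_scope.
Local Open Scope ring_scope.
Local Open Scope complex_scope.

Set Implicit Arguments.
Unset Strict Implicit.
Unset Printing Implicit Defensive.

(** * Wirtinger derivatives *)

(** With df = a dz + b dzbar the derivatives along 1 and i are [a + b] and [i * (a - b)]. This lemma
    and the next invert that system. *)
Lemma wirt_inv (F : fieldType) (i a b : F) :
  (2 : F) != 0 -> i ^+ 2 = -1 -> 2^-1 * (a + b - i * (i * (a - b))) = a.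
Proof. by move=> n2 i2; rewrite mulrA -expr2 i2; field. Qed.

Lemma wirtbar_inv (F : fieldType) (i a b : F) :
  (2 : F) != 0 -> i ^+ 2 = -1 -> 2^-1 * (a + b + i * (i * (a - b))) = b.
Proof. by move=> n2 i2; rewrite mulrA -expr2 i2; field. Qed.

Lemma product_slope (F : fieldType) (h f0 f1 g0 g1 : F) :
  h^-1 * (f1 - f0) * g1 + f0 * (h^-1 * (g1 - g0)) = h^-1 * (f1 * g1 - f0 * g0).
Proof. by ring. Qed.

Lemma inv_slope (F : fieldType) (h f0 f1 : F) : f0 != 0 -> f1 != 0 ->
  - (h^-1 * (f1 - f0) * (f1^-1 * f0^-1)) = h^-1 * (f1^-1 - f0^-1).
(* Generalizing [h^-1] spares [field] the side condition [h != 0]. *)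
Proof. by move=> n0 n1; move: (h^-1) => k; field; rewrite n0 n1. Qed.

Lemma has_wirtM_aux (F : fieldType) (i a b a' b' f g : F) :
  i * (a - b) * g + f * (i * (a' - b')) = i * (a * g + f * a' - (b * g + f * b')).
Proof. by ring. Qed.

Lemma has_wirtM_aux1 (F : fieldType) (a b a' b' f g : F) :
  (a + b) * g + f * (a' + b') = a * g + f * a' + (b * g + f * b').
Proof. by ring. Qed.

Lemma has_wirtD_aux (F : fieldType) (i a b a' b' : F) :
  i * (a - b) + i * (a' - b') = i * (a + a' - (b + b')).
Proof. by ring. Qed.

Lemma has_wirt_scale_aux (F : fieldType) (i a b c : F) :
  - (i * (a - b) * c) = i * (- (a * c) - - (b * c)).
Proof. by ring. Qed.

Section Wirtinger.
Variable R : realType.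
Local Notation C := R[i].
Implicit Types (f g : C -> C) (z v a b l : C).

Lemma C2_neq0 : (2 : C) != 0.
Proof. by rewrite pnatr_eq0. Qed.

Lemma cvg_conjc {T : Type} (F : set_system T) {FF : Filter F} (f : T -> C) l :
  f x @[x --> F] --> l -> (f x)^*%C @[x --> F] --> l^*%C.
Proof.
move=> /cvgrPdist_lt fl; apply/cvgrPdist_lt => e e0.
by apply: filterS (fl e e0) => x /=; rewrite -rmorphB normcJ.
Qed.

Lemma cvg_real_complex {T : Type} (F : set_system T) {FF : Filter F}
    (f : T -> R) (l : R) :
  f x @[x --> F] --> l -> (f x)%:C @[x --> F] --> l%:C.
Proof.
move=> /cvgrPdist_lt fl; apply/cvgrPdist_lt => -[e e'].
(* In the order of [C], positivity forces a zero imaginary part, so the radius is a real number. *)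
rewrite ltcE /= => /andP[/eqP-> e0].
apply: filterS (fl e e0) => x /=.
by rewrite -rmorphB /= normc_def /= expr0n addr0 sqrtr_sqr ltcR.
Qed.

Lemma cvg_Re {T : Type} (F : set_system T) {FF : Filter F} (f : T -> C) l :
  f x @[x --> F] --> l -> complex.Re (f x) @[x --> F] --> complex.Re l.
Proof.
move=> /cvgrPdist_lt fl; apply/cvgrPdist_lt => e e0.
have e0C : 0 < e%:C by rewrite ltcR.
apply: filterS (fl _ e0C) => x /= h.
rewrite -ltcR; apply: le_lt_trans h.
by rewrite -raddfB; exact: normc_ge_Re.
Qed.

Definition has_cderiv f z l : Prop :=
  h^-1 * (f (z + h) - f z) @[h --> (0 : C)^'] --> l.

Definition has_dirderiv f z v l : Prop :=
  (h%:C)^-1 * (f (z + v * h%:C) - f z) @[h --> (0 : R)^'] --> l.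

(* [dz] and [dzbar] are defined by [lim], which carries no information when the
   limit does not exist; [has_wirt f z a b] asserts that both directional
   derivatives exist and that df = a dz + b dzbar on them. *)
Definition has_wirt f z a b : Prop :=
  has_dirderiv f z 1 (a + b) /\ has_dirderiv f z 'i ('i * (a - b)).

Lemma has_dirderiv_unique f z v l m :
  has_dirderiv f z v l -> has_dirderiv f z v m -> l = m.
Proof.
move=> hl hm.
transitivity (lim ((h%:C)^-1 * (f (z + v * h%:C) - f z) @[h --> (0 : R)^'])).
- by apply: esym; apply: (@cvg_lim C); [exact: norm_hausdorff | exact: hl].
- by apply: (@cvg_lim C); [exact: norm_hausdorff | exact: hm].
Qed.

Lemma lim_re f z l : has_dirderiv f z 1 l -> partial_re f z = l.
Proof.
move=> h; rewrite /partial_re; apply: (@cvg_lim C); first exact: norm_hausdorff.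
by move: h; rewrite /has_dirderiv; under eq_fun do rewrite mul1r.
Qed.

Lemma lim_im f z l : has_dirderiv f z 'i l -> partial_im f z = l.
Proof.
by move=> h; rewrite /partial_im; apply: (@cvg_lim C); first exact: norm_hausdorff.
Qed.

Lemma has_wirt_dz f z a b : has_wirt f z a b -> dz f z = a.
Proof.
case=> h1 h2; rewrite /dz (lim_re h1) (lim_im h2).
exact: wirt_inv C2_neq0 (sqr_i R).
Qed.

Lemma has_wirt_dzbar f z a b : has_wirt f z a b -> dzbar f z = b.
Proof.
case=> h1 h2; rewrite /dzbar (lim_re h1) (lim_im h2).
exact: wirtbar_inv C2_neq0 (sqr_i R).
Qed.

(** The target is the full neighbourhood filter of [z], so [v] is arbitrary and whatever holds near
    [z] holds for small real steps along [v]. *)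
Lemma dnbhs_line z v : z + v * h%:C @[h --> (0 : R)^'] --> z.
Proof.
have h0 : (h%:C : C) @[h --> (0 : R)^'] --> (0 : R)%:C.
  by apply: cvg_real_complex; exact: cvg_within.
rewrite -[X in _ --> X]addr0 -[X in _ --> _ + X](mulr0 v).
apply: cvgD; first exact: cvg_cst.
apply: cvgM; [exact: cvg_cst | exact: h0].
Qed.

Lemma has_dirderiv_near f g z v l :
  (\forall w \near z, f w = g w) -> has_dirderiv f z v l -> has_dirderiv g z v l.
Proof.
move=> fg; rewrite /has_dirderiv => hf.
apply: cvg_trans hf; apply: near_eq_cvg.
have fg' : \forall h \near (0 : R)^', f (z + v * h%:C) = g (z + v * h%:C).
  exact: (@dnbhs_line z v _ fg).
by apply: filterS fg' => h /= ->; rewrite (nbhs_singleton fg).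
Qed.

(** For [h != 0] the value is [f z] plus [h] times the difference quotient, and this product tends
    to zero. Such continuity along one line is what the product and inverse rules use. *)
Lemma has_dirderiv_cvg f z v l : has_dirderiv f z v l ->
  f (z + v * h%:C) @[h --> (0 : R)^'] --> f z.
Proof.
move=> hf.
have h0 : (h%:C : C) @[h --> (0 : R)^'] --> (0 : R)%:C.
  by apply: cvg_real_complex; exact: cvg_within.
have : f z + h%:C * ((h%:C)^-1 * (f (z + v * h%:C) - f z)) @[h --> (0 : R)^']
    --> f z + 0%:C * l.
  apply: cvgD.
    exact: cvg_cst.
  exact: (cvgM h0 hf).
rewrite mul0r addr0; apply: cvg_trans; apply: near_eq_cvg.
apply: filterS (nbhs_dnbhs_neq (0 : R)) => h hn.
rewrite /= mulrA divff ?mul1r; first by rewrite addrCA subrr addr0.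
by rewrite -[0](rmorph0 (real_complex R)) (inj_eq (@complexI R)).
Qed.

Lemma has_dirderivD f g z v l m : has_dirderiv f z v l -> has_dirderiv g z v m ->
  has_dirderiv (fun w => f w + g w) z v (l + m).
Proof.
move=> hf hg; have : (h%:C)^-1 * (f (z + v * h%:C) - f z)
    + (h%:C)^-1 * (g (z + v * h%:C) - g z) @[h --> (0 : R)^'] --> l + m.
  exact: (cvgD hf hg).
apply: cvg_trans; apply: near_eq_cvg.
by apply: nearW => h /=; rewrite -mulrDr opprD addrACA.
Qed.

Lemma has_dirderivM f g z v l m : has_dirderiv f z v l -> has_dirderiv g z v m ->
  has_dirderiv (fun w => f w * g w) z v (l * g z + f z * m).
Proof.
move=> hf hg.
have : (h%:C)^-1 * (f (z + v * h%:C) - f z) * g (z + v * h%:C)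
    + f z * ((h%:C)^-1 * (g (z + v * h%:C) - g z)) @[h --> (0 : R)^']
    --> l * g z + f z * m.
  exact: (cvgD (cvgM hf (has_dirderiv_cvg hg)) (cvgM (cvg_cst (f z)) hg)).
apply: cvg_trans; apply: near_eq_cvg.
apply: nearW => h /=; exact: product_slope.
Qed.

Lemma has_dirderivV f z v l : f z != 0 -> has_dirderiv f z v l ->
  has_dirderiv (fun w => (f w)^-1) z v (- (l / f z ^+ 2)).
Proof.
move=> f0 hf; have hc := has_dirderiv_cvg hf.
have : - ((h%:C)^-1 * (f (z + v * h%:C) - f z) * ((f (z + v * h%:C))^-1 * (f z)^-1))
    @[h --> (0 : R)^'] --> - (l * ((f z)^-1 * (f z)^-1)).
  exact: (cvgN (cvgM hf (cvgM (cvgV f0 hc) (cvg_cst ((f z)^-1))))).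
rewrite -expr2 exprVn.
apply: cvg_trans; apply: near_eq_cvg.
have : \forall h \near (0 : R)^', f (z + v * h%:C) != 0.
  exact: (cvgr_neq0 _ hc f0).
apply: filterS => h /= fh0; exact: inv_slope.
Qed.

Lemma has_dirderiv_cst c z v : has_dirderiv (fun=> c) z v 0.
Proof.
rewrite /has_dirderiv; under eq_fun do rewrite subrr mulr0.
exact: cvg_cst.
Qed.

Lemma has_dirderiv_sum (I : Type) (r : seq I) (P : pred I) (F : I -> C -> C) z v
    (L : I -> C) :
  (forall i, P i -> has_dirderiv (F i) z v (L i)) ->
  has_dirderiv (fun w => \sum_(i <- r | P i) F i w) z v (\sum_(i <- r | P i) L i).
Proof.
move=> h; elim: r => [|i r IH].
  rewrite big_nil; under [X in has_dirderiv X]eq_fun do rewrite big_nil.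
  exact: has_dirderiv_cst.
rewrite big_cons; under [X in has_dirderiv X]eq_fun do rewrite big_cons.
case: ifPn => Pi; [exact: (has_dirderivD (h _ Pi) IH) | exact: IH].
Qed.

Lemma has_cderiv_dir f z v l : v != 0 -> has_cderiv f z l -> has_dirderiv f z v (v * l).
Proof.
move=> v0 hf.
(* Since [v != 0], nonzero real steps give nonzero complex steps, so the limit over the punctured
   complex neighbourhood restricts to the line. *)
have h0 : v * h%:C @[h --> (0 : R)^'] --> (0 : C)^'.
  move=> A A0.
  have B : \forall h \near (0 : R)^', 0 + v * h%:C != 0 -> A (0 + v * h%:C).
    exact: (@dnbhs_line 0 v _ A0).
  have B' := nbhs_dnbhs_neq (0 : R).
  apply: (@filterS2 _ (0 : R)^' _ _ _ _ _ B B') => h; rewrite /= add0r => Ah hn.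
  apply: Ah; rewrite mulf_neq0 //.
  by rewrite -[0](rmorph0 (real_complex R)) (inj_eq (@complexI R)).
have : v * ((v * h%:C)^-1 * (f (z + v * h%:C) - f z)) @[h --> (0 : R)^'] --> v * l.
  exact: (cvgM (cvg_cst v) (cvg_comp _ _ h0 hf)).
apply: cvg_trans; apply: near_eq_cvg; apply: nearW => h /=.
by rewrite invfM !mulrA divff // mul1r.
Qed.

(** The Cauchy-Riemann equations: the derivatives along 1 and i are [l] and ['i * l]. *)
Lemma has_cderiv_wirt f z l : has_cderiv f z l -> has_wirt f z l 0.
Proof.
move=> h; split.
  by have := has_cderiv_dir (oner_neq0 _) h; rewrite mul1r addr0.
rewrite subr0; exact: (has_cderiv_dir (neq0Ci _) h).
Qed.


Lemma has_wirt_near f g z a b :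
  (\forall w \near z, f w = g w) -> has_wirt f z a b -> has_wirt g z a b.
Proof.
move=> fg [h1 h2]; split.
- exact: (has_dirderiv_near fg h1).
- exact: (has_dirderiv_near fg h2).
Qed.

Lemma has_wirt_cst c z : has_wirt (fun=> c) z 0 0.
Proof.
split.
- rewrite addr0; exact: (has_dirderiv_cst c z 1).
- rewrite subr0 mulr0; exact: (has_dirderiv_cst c z 'i).
Qed.

Lemma has_wirtD f g z a b a' b' : has_wirt f z a b -> has_wirt g z a' b' ->
  has_wirt (fun w => f w + g w) z (a + a') (b + b').
Proof.
move=> [f1 f2] [g1 g2]; split.
- rewrite addrACA; exact: (has_dirderivD f1 g1).
- rewrite -has_wirtD_aux; exact: (has_dirderivD f2 g2).
Qed.

Lemma has_wirtM f g z a b a' b' : has_wirt f z a b -> has_wirt g z a' b' ->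
  has_wirt (fun w => f w * g w) z (a * g z + f z * a') (b * g z + f z * b').
Proof.
move=> [f1 f2] [g1 g2]; split.
- rewrite -has_wirtM_aux1; exact: (has_dirderivM f1 g1).
- rewrite -has_wirtM_aux; exact: (has_dirderivM f2 g2).
Qed.

Lemma has_wirtN f z a b : has_wirt f z a b ->
  has_wirt (fun w => - f w) z (- a) (- b).
Proof.
move=> h; have := has_wirtM (has_wirt_cst (-1) z) h.
rewrite !mul0r !add0r !mulN1r.
by under [X in has_wirt X]eq_fun do rewrite mulN1r.
Qed.

Lemma has_wirtV f z a b : f z != 0 -> has_wirt f z a b ->
  has_wirt (fun w => (f w)^-1) z (- (a / f z ^+ 2)) (- (b / f z ^+ 2)).
Proof.
move=> f0 [f1 f2]; split.
- rewrite -opprD -mulrDl; exact: (has_dirderivV f0 f1).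
- rewrite -has_wirt_scale_aux; exact: (has_dirderivV f0 f2).
Qed.

Lemma has_wirt_sum (I : Type) (r : seq I) (P : pred I) (F : I -> C -> C) z
    (A B : I -> C) :
  (forall i, P i -> has_wirt (F i) z (A i) (B i)) ->
  has_wirt (fun w => \sum_(i <- r | P i) F i w) z
    (\sum_(i <- r | P i) A i) (\sum_(i <- r | P i) B i).
Proof.
move=> h; split.
- rewrite -big_split; apply: has_dirderiv_sum => i Pi; exact: (h i Pi).1.
- rewrite -sumrB mulr_sumr; apply: has_dirderiv_sum => i Pi; exact: (h i Pi).2.
Qed.

Lemma has_dirderiv_conj f z v l : has_dirderiv f z v l ->
  has_dirderiv (fun w => (f w)^*%C) z v l^*%C.
Proof.
move=> h.
have : ((x%:C)^-1 * (f (z + v * x%:C) - f z))^*%C @[x --> (0 : R)^'] --> l^*%C.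
  exact: (cvg_conjc h).
apply: cvg_trans; apply: near_eq_cvg; apply: nearW => x /=.
rewrite rmorphM rmorphB fmorphV.
exact: (congr1 (fun c : C => c^-1 * _) (conjc_real x)).
Qed.

(** The steps are real, so each directional derivative is conjugated. As ['i] changes sign,
    ['i * (a - b)] becomes ['i * (b^*%C - a^*%C)], and the two coefficients trade places. *)
Lemma has_wirt_conj f z a b : has_wirt f z a b ->
  has_wirt (fun w => (f w)^*%C) z b^*%C a^*%C.
Proof.
move=> [h1 h2]; split.
- rewrite addrC -rmorphD; exact: (has_dirderiv_conj h1).
- rewrite (_ : 'i * (b^*%C - a^*%C) = ('i * (a - b))^*%C).
    exact: (has_dirderiv_conj h2).
  have ci : conjc ('i : C) = - 'i by apply/eqP; rewrite eq_complex /= oppr0 !eqxx.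
  have cM : conjc ('i * (a - b)) = conjc 'i * (conjc a - conjc b).
    by rewrite rmorphM rmorphB.
  by rewrite cM ci mulNr -mulrN opprB.
Qed.

(** Links bare difference quotients at 0 to [is_derive], which gives access to the real chain rule
    and the derivative of [ln]. *)
Lemma is_derive_slope (phi : R -> R) (l : R) :
  h^-1 * (phi h - phi 0) @[h --> 0^'] --> l <-> is_derive (0 : R) 1 phi l.
Proof.
have E : (fun h : R => h^-1 *: ((phi \o shift 0) (h *: (1 : R)) - phi 0)) =
         (fun h => h^-1 * (phi h - phi 0)).
  by apply/funext => h /=; rewrite addr0 /GRing.scale /= mulr1.
split=> [h|[h1 h2]].
  apply: DeriveDef; first by rewrite /derivable E; apply/cvg_ex; exists l.
  rewrite /derive E; apply: (@cvg_lim R); [exact: norm_hausdorff | exact: h].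
by move: h1; rewrite /derivable -h2 /derive E.
Qed.

Lemma slope_real (k x y : R) : (k%:C)^-1 * (x%:C - y%:C) = (k^-1 * (x - y))%:C :> C.
Proof. by rewrite rmorphM rmorphB fmorphV. Qed.

(** On the line through [z] along [v], [K] is minus the real logarithm of the real function [phi]
    whose complex image is [F]. The real chain rule at 0 gives the derivative, which is then carried
    back to [C]. *)
Lemma has_dirderiv_log (K : C -> R) (F : C -> C) z v l :
  (\forall w \near z, (expR (- K w))%:C = F w) ->
  has_dirderiv F z v l -> has_dirderiv (fun w => (K w)%:C) z v (- (l / F z)).
Proof.
move=> KF hF.
have Fz := nbhs_singleton KF.
set phi := fun h : R => expR (- K (z + v * h%:C)).
have hE : has_dirderiv (fun w => (expR (- K w))%:C) z v l.
  apply: has_dirderiv_near hF; apply: filterS KF => w; exact: esym.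
have phi0 : phi 0 = expR (- K z) by rewrite /phi mulr0 addr0.
have sl : h^-1 * (phi h - phi 0) @[h --> (0 : R)^'] --> complex.Re l.
  have : complex.Re ((h%:C)^-1 * ((expR (- K (z + v * h%:C)))%:C - (expR (- K z))%:C))
      @[h --> (0 : R)^'] --> complex.Re l by exact: (cvg_Re hE).
  apply: cvg_trans; apply: near_eq_cvg; apply: nearW => h.
  rewrite phi0; exact: (congr1 (@complex.Re R) (slope_real _ _ _)).
(* A limit of real difference quotients is real, so nothing is lost by passing to [complex.Re l]. *)
have lE : l = (complex.Re l)%:C.
  apply: (has_dirderiv_unique hE); rewrite /has_dirderiv.
  have : (h^-1 * (phi h - phi 0))%:C @[h --> (0 : R)^'] --> (complex.Re l)%:C.
    exact: (cvg_real_complex sl).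
  apply: cvg_trans; apply: near_eq_cvg; apply: nearW => h.
  rewrite phi0; exact: esym (slope_real _ _ _).
have d1 := (is_derive_slope phi (complex.Re l)).1 sl.
have d2 := is_derive1_ln (expR_gt0 (- K z)).
rewrite -phi0 in d2.
have d3 := (is_derive_slope _ _).2 (is_derive1_comp d2 d1).
have : (- (h^-1 * ((@ln R \o phi) h - (@ln R \o phi) 0)))%:C @[h --> (0 : R)^']
    --> (- ((phi 0)^-1 * complex.Re l))%:C.
  exact: (cvg_real_complex (cvgN d3)).
rewrite -Fz lE -fmorphV -rmorphM -rmorphN mulrC -phi0.
apply: cvg_trans; apply: near_eq_cvg; apply: nearW => h.
rewrite slope_real; congr (_ %:C).
by rewrite /= /phi !expRK mulr0 addr0 -mulrN opprB opprK addrC.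
Qed.

Lemma has_wirt_log (K : C -> R) (F : C -> C) z a b :
  (\forall w \near z, (expR (- K w))%:C = F w) ->
  has_wirt F z a b -> has_wirt (fun w => (K w)%:C) z (- (a / F z)) (- (b / F z)).
Proof.
move=> KF [h1 h2]; split.
- rewrite -opprD -mulrDl; exact: (has_dirderiv_log KF h1).
- rewrite -has_wirt_scale_aux; exact: (has_dirderiv_log KF h2).
Qed.
End Wirtinger.

(** * Chain rule, vector-valued functions, and the Leibniz rule for the cup product *)

Section WirtingerVectors.
Variable R : realType.
Local Notation C := R[i].
Implicit Types (f g : C -> C) (z v a b l : C).

Lemma derivable_derive1 (V : normedModType C) (f : C -> V) z : derivable f z 1 ->
  k^-1 *: (f (k + z) - f z) @[k --> (0 : C)^'] --> derive1 f z.
Proof.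
rewrite /derivable.
have -> : (fun k : C => k^-1 *: ((f \o shift z) (k *: 1) - f z)) =
          (fun k => k^-1 *: (f (k + z) - f z)).
  by apply/funext => k; rewrite /= [k *: 1](mulr1 k).
move=> h; exact: h.
Qed.

Lemma derivable_cderiv f z : derivable f z 1 -> has_cderiv f z (derive1 f z).
Proof.
move=> /derivable_derive1; apply: cvg_trans; apply: near_eq_cvg; apply: nearW => k.
by rewrite /= [k + z]addrC.
Qed.

Lemma derivable_coord n (f : C -> 'rV[C]_n.+1) z j :
  derivable f z 1 -> has_cderiv (fun w => f w 0 j) z (derive1 f z 0 j).
Proof.
move=> /derivable_derive1 h.
have := cvg_comp _ _ h (@coord_continuous C _ _ 0 j (derive1 f z)).
apply: cvg_trans; apply: near_eq_cvg; apply: nearW => k.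
by rewrite /= !mxE [k + z]addrC.
Qed.

Lemma derivable_cvg f z : derivable f z 1 -> f w @[w --> z] --> f z.
Proof. by move=> /derivable1_diffP /differentiable_continuous. Qed.

Lemma holomorphic_wirt f z : derivable f z 1 -> has_wirt f z (derive1 f z) 0.
Proof. by move=> /derivable_cderiv /has_cderiv_wirt. Qed.

(** Caratheodory's form of differentiability: the slope, given the value [m] at [t], is continuous
    there. In the chain rule it avoids dividing by an increment of the inner function that may
    vanish. *)
Lemma has_cderiv_slope g t m : has_cderiv g t m ->
  exists2 q : C -> C, q w @[w --> t] --> m & forall w, g w - g t = q w * (w - t).
Proof.
move=> hg; exists (fun w => if w == t then m else (w - t)^-1 * (g w - g t)); last first.
  move=> w; case: eqVneq => [->|wt]; first by rewrite !subrr mulr0.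
  by rewrite mulrAC mulVf ?mul1r // subr_eq0.
move=> A Am.
have B : \forall k \near (0 : C), k != 0 -> A (k^-1 * (g (t + k) - g t)).
  exact: (hg A Am).
apply/nbhs0P; apply: filterS B => k /=.
have -> : (t + k == t) = (k == 0) by rewrite -subr_eq0 addrC addKr.
have -> : t + k - t = k by rewrite addrC addKr.
by case: eqVneq => [_ _|kn /(_ isT)//]; exact: (nbhs_singleton Am).
Qed.

Lemma has_dirderiv_comp f g z v l m : has_cderiv g (f z) m -> has_dirderiv f z v l ->
  has_dirderiv (g \o f) z v (m * l).
Proof.
move=> /has_cderiv_slope[q qm qE] hf.
have : q (f (z + v * h%:C)) * ((h%:C)^-1 * (f (z + v * h%:C) - f z))
    @[h --> (0 : R)^'] --> m * l.
  exact: (cvgM (cvg_comp _ _ (has_dirderiv_cvg hf) qm) hf).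
apply: cvg_trans; apply: near_eq_cvg; apply: nearW => h.
by rewrite /= qE mulrCA.
Qed.

Lemma has_wirt_comp f g z a b m : has_cderiv g (f z) m -> has_wirt f z a b ->
  has_wirt (g \o f) z (m * a) (m * b).
Proof.
move=> hg [h1 h2]; split.
- rewrite -mulrDr; exact: (has_dirderiv_comp hg h1).
- rewrite -mulrBr mulrCA; exact: (has_dirderiv_comp hg h2).
Qed.

Definition has_vwirt n (x : C -> 'rV[C]_n) z (a b : 'rV[C]_n) : Prop :=
  forall j, has_wirt (fun w => x w 0 j) z (a 0 j) (b 0 j).

Lemma holomorphic_vwirt n (x : C -> 'rV[C]_n.+1) z :
  derivable x z 1 -> has_vwirt x z (derive1 x z) 0.
Proof.
move=> h j; rewrite [X in has_wirt _ _ _ X]mxE.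
exact: (has_cderiv_wirt (@derivable_coord _ _ _ j h)).
Qed.

Lemma has_vwirt_conj n (x : C -> 'rV[C]_n) z (a b : 'rV[C]_n) : has_vwirt x z a b ->
  has_vwirt (fun w => conj_mx (x w)) z (conj_mx b) (conj_mx a).
Proof.
move=> h j; have := has_wirt_conj (h j).
have cE (v : 'rV[C]_n) : conj_mx v 0 j = conjc (v 0 j) by rewrite mxE.
rewrite !cE; under [X in _ -> has_wirt X _ _ _]eq_fun do rewrite cE; exact.
Qed.

Lemma cupE (x y : 'rV[C]_22) :
  cup x y = \sum_k (\sum_j x 0 j * ZtoC R K3_gram j k) * y 0 k.
Proof.
rewrite /cup mxE; apply: eq_bigr => k _; rewrite !mxE; congr (_ * _).
Qed.

Lemma has_wirt_cup (x y : C -> 'rV[C]_22) z (a b a' b' : 'rV[C]_22) :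
  has_vwirt x z a b -> has_vwirt y z a' b' ->
  has_wirt (fun w => cup (x w) (y w)) z
    (cup a (y z) + cup (x z) a') (cup b (y z) + cup (x z) b').
Proof.
move=> hx hy.
rewrite !cupE -!big_split.
under [X in has_wirt X]eq_fun do rewrite cupE.
apply: has_wirt_sum => k _; apply: has_wirtM (hy k).
apply: has_wirt_sum => j _.
have := has_wirtM (hx j) (has_wirt_cst (ZtoC R K3_gram j k) z).
by rewrite !mulr0 !addr0.
Qed.

Lemma has_vwirt_mulmx n p (x : C -> 'rV[C]_n) z (a b : 'rV[C]_n) (M : 'M[C]_(n, p)) :
  has_vwirt x z a b -> has_vwirt (fun w => x w *m M) z (a *m M) (b *m M).
Proof.
move=> hx j; rewrite !mxE; under [X in has_wirt X]eq_fun do rewrite mxE.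
apply: has_wirt_sum => k _.
have := has_wirtM (hx k) (has_wirt_cst (M k j) z).
by rewrite !mulr0 !addr0.
Qed.

Lemma has_wirt_unique f z a b a' b' :
  has_wirt f z a b -> has_wirt f z a' b' -> a = a' /\ b = b'.
Proof.
move=> h h'; split.
- by rewrite -(has_wirt_dz h) (has_wirt_dz h').
- by rewrite -(has_wirt_dzbar h) (has_wirt_dzbar h').
Qed.
End WirtingerVectors.

(** * Gram matrices and the cup product *)

(** Minus the inverse of the E8 Cartan matrix in the labelling of [E8_edge]. It is integral because
    E8 is unimodular, and it shows that [\det E8_gram] is nonzero without expanding an 8 by 8
    determinant. *)
Definition E8_inv : 'M[int]_8 := \matrix_(i, j)
  - (nth 0%N (nth [::]
    [:: [:: 2; 3; 4; 5; 6; 4; 2; 3]; [:: 3; 6; 8; 10; 12; 8; 4; 6];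
        [:: 4; 8; 12; 15; 18; 12; 6; 9]; [:: 5; 10; 15; 20; 24; 16; 8; 12];
        [:: 6; 12; 18; 24; 30; 20; 10; 15]; [:: 4; 8; 12; 16; 20; 14; 7; 10];
        [:: 2; 4; 6; 8; 10; 7; 4; 5]; [:: 3; 6; 9; 12; 15; 10; 5; 8]] i) j)%:Z.

Lemma E8_gram_inv : E8_gram *m E8_inv = 1%:M.
Proof.
apply/matrixP => i j; rewrite !mxE; under eq_bigr do rewrite !mxE -val_eqE.
rewrite !big_ord_recl big_ord0 -val_eqE.
case: i => [i hi]; case: j => [j hj].
by do 8?[case: i hi => [|i] hi //]; do 8?[case: j hj => [|j] hj //]; vm_compute.
Qed.

Lemma det_E8_gram : \det E8_gram != 0.
Proof.
apply/eqP => d0; have := congr1 determinant E8_gram_inv.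
by rewrite det_mulmx d0 mul0r det1.
Qed.

Lemma det_osum m n (A : 'M[int]_m) (B : 'M[int]_n) :
  \det (osum A B) = \det A * \det B.
Proof. exact: det_ublock. Qed.

Lemma det_U_gram : \det U_gram != 0.
Proof.
by rewrite (expand_det_row _ ord0) !big_ord_recl big_ord0 /cofactor !det_mx11 !mxE.
Qed.

Lemma det_M_gram n : (1 <= n)%N -> \det (M_gram n) != 0.
Proof.
(* The size 19 and the nested block sizes agree by computation, so the product is folded into one
   block determinant and matched by [erefl]. The last factor is nonzero because [n] is positive. *)
move=> n1; have -> : \det (M_gram n) =
    \det U_gram * (\det E8_gram * (\det E8_gram * - (2 * n)%N%:Z)).
  rewrite -[- (2 * n)%N%:Z]det_scalar1 -!det_osum; exact: erefl.
by rewrite !mulf_neq0 ?det_U_gram ?det_E8_gram // oppr_eq0; case: n n1.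
Qed.

Lemma det_K3_gram : \det K3_gram != 0.
Proof.
have -> : \det K3_gram =
    \det U_gram * (\det U_gram * (\det U_gram * (\det E8_gram * \det E8_gram))).
  rewrite -!det_osum; exact: erefl.
by rewrite !mulf_neq0 ?det_U_gram ?det_E8_gram.
Qed.

Lemma tr_osum m n (A : 'M[int]_m) (B : 'M[int]_n) :
  (osum A B)^T = osum A^T B^T.
Proof. by rewrite /osum tr_block_mx !trmx0. Qed.

Lemma K3_gram_sym : K3_gram^T = K3_gram.
Proof.
have U : U_gram^T = U_gram by apply/matrixP => i j; rewrite !mxE eq_sym.
have E : E8_gram^T = E8_gram.
  by apply/matrixP => i j; rewrite !mxE eq_sym orbC.
rewrite -[LHS]/(trmx (osum U_gram (osum U_gram (osum U_gram (osum E8_gram E8_gram))))).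
by rewrite !tr_osum U E.
Qed.

(** * Spanning a space of dimension at most three *)

Section LinearAlgebra.
Variable F : fieldType.

(** Independence gives the stacked matrix [A] rank 3. Its row space lies in [T], whose rank is at
    most 3, so the two coincide. *)
Lemma rank3_span m n (T : 'M[F]_(m, n)) (x y z w : 'rV[F]_n) :
  (\rank T <= 3)%N ->
  [/\ (x <= T)%MS, (y <= T)%MS, (z <= T)%MS & (w <= T)%MS] ->
  (forall a b c, a *: x + b *: y + c *: z = 0 -> [/\ a = 0, b = 0 & c = 0]) ->
  exists a b c, w = a *: x + b *: y + c *: z.
Proof.
move=> rT [xT yT zT wT] free.
pose A := col_mx x (col_mx y z).
have AE (v : 'rV[F]_(1 + (1 + 1))) : v *m A =
    v 0 (lshift _ 0) *: x + v 0 (rshift 1 (lshift 1 0)) *: y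
    + v 0 (rshift 1 (rshift 1 0)) *: z.
  rewrite -[v in LHS]hsubmxK mul_row_col -[rsubmx v]hsubmxK mul_row_col.
  rewrite [lsubmx v]mx11_scalar [lsubmx (rsubmx v)]mx11_scalar.
  rewrite [rsubmx (rsubmx v)]mx11_scalar.
  by rewrite !mul_scalar_mx addrA !mxE.
have Afree : row_free A.
  apply: inj_row_free => v; rewrite AE => /free[h1 h2 h3].
  apply/rowP => j; rewrite [RHS]mxE.
  case: (splitP j) => [k|k] jk.
    by rewrite (_ : j = lshift _ 0) //; apply/val_inj; rewrite /= jk ord1.
  case: (splitP k) => [l|l] kl.
    rewrite (_ : j = rshift 1 (lshift 1 0)) //; apply/val_inj => /=.
    by rewrite jk kl ord1.
  rewrite (_ : j = rshift 1 (rshift 1 0)) //; apply/val_inj => /=.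
  by rewrite jk kl ord1.
have AT : (A <= T)%MS by rewrite !col_mx_sub xT yT zT.
have /eqP rA : \rank A == 3 by exact: Afree.
have TA : (T <= A)%MS.
  by rewrite -(geq_leqif (mxrank_leqif_sup AT)) rA.
have /submxP[D ->] := submx_trans wT TA.
by rewrite AE; do 3!eexists.
Qed.
End LinearAlgebra.

(** The left side is minus the Hermitian Gram determinant of s and s'. With [be] and [ga] the
    coefficients of s' and conj s in conj s', its nonvanishing reduces to that of [be]. *)
Lemma gram4_aux (F : fieldType) (a00 a10 a01 a11 al be ga Y : F) :
  a01 = ga * a00 -> a11 = - be * Y + ga * a10 ->
  a10 * a01 - a11 * a00 = a00 * be * Y.
Proof. by move=> -> ->; ring. Qed.

(** * The cup product, and linear algebra on the transcendental space at one point *)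

Section CupProduct.
Variable R : realType.
Local Notation C := R[i].
Implicit Types (x y z : 'rV[C]_22) (a : C).

Lemma conjcMK (a b : C) : (a * b^*%C)^*%C = a^*%C * b.
Proof. by rewrite -[in RHS](conjcK b); exact: rmorphM. Qed.

Lemma cupDl x y z : cup (x + y) z = cup x z + cup y z.
Proof. by rewrite /cup !mulmxDl mxE. Qed.

Lemma cupDr x y z : cup x (y + z) = cup x y + cup x z.
Proof. by rewrite /cup linearD mulmxDr mxE. Qed.

Lemma cupZl a x y : cup (a *: x) y = a * cup x y.
Proof. by rewrite /cup -!scalemxAl mxE. Qed.

Lemma cupZr a x y : cup x (a *: y) = a * cup x y.
Proof. by rewrite /cup linearZ -scalemxAr mxE. Qed.

Lemma cupNl x y : cup (- x) y = - cup x y.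
Proof. by rewrite -scaleN1r cupZl mulN1r. Qed.

Lemma cup0l x : cup 0 x = 0.
Proof. by rewrite -(scale0r (0 : 'rV[C]_22)) cupZl mul0r. Qed.

Lemma cupC x y : cup x y = cup y x.
Proof.
rewrite /cup -[in RHS](trmxK (y *m _ *m _)) [in RHS]mxE !trmx_mul trmxK -mulmxA.
by rewrite /ZtoC map_trmx K3_gram_sym mulmxA.
Qed.

Lemma conj_ZtoC m n (A : 'M[int]_(m, n)) : conj_mx (ZtoC R A) = ZtoC R A.
Proof. by apply/matrixP => i j; rewrite !mxE; exact: rmorph_int. Qed.

Lemma conj_mxM m n p (A : 'M[C]_(m, n)) (B : 'M[C]_(n, p)) :
  conj_mx (A *m B) = conj_mx A *m conj_mx B.
Proof. exact: map_mxM. Qed.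

Lemma conj_mxK m n (A : 'M[C]_(m, n)) : conj_mx (conj_mx A) = A.
Proof. by apply/matrixP => i j; rewrite !mxE conjcK. Qed.

Lemma cup_conj x y : cup (conj_mx x) (conj_mx y) = (cup x y)^*%C.
Proof.
have -> : (cup x y)^*%C = conj_mx (x *m ZtoC R K3_gram *m y^T) 0 0 by rewrite [RHS]mxE.
by rewrite !conj_mxM conj_ZtoC /cup /conj_mx -map_trmx.
Qed.

Lemma cup_nondegenerate x : (forall y, cup x y = 0) -> x = 0.
Proof.
move=> h; have xK : x *m ZtoC R K3_gram = 0.
  apply/rowP => j; have := h (delta_mx 0 j).
  by rewrite /cup trmx_delta -colE !mxE.
have Ku : ZtoC R K3_gram \in unitmx.
  by rewrite unitmxE unitfE det_map_mx intr_eq0 det_K3_gram.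
by rewrite -(mulmxK Ku x) xK mul0mx.
Qed.

Variables (n : nat) (P : 'M[int]_(19, 22)).
Hypotheses (n_gt0 : (1 <= n)%N) (P_isometric : P *m K3_gram *m P^T = M_gram n).

Let T := kermx (ZtoC R K3_gram *m (ZtoC R P)^T).

Lemma unit_M_gram : ZtoC R (M_gram n) \in unitmx.
Proof. by rewrite unitmxE unitfE det_map_mx intr_eq0 det_M_gram. Qed.

Lemma ZtoC_isometric : ZtoC R P *m (ZtoC R K3_gram *m (ZtoC R P)^T) = ZtoC R (M_gram n).
Proof. by rewrite -P_isometric /ZtoC !map_mxM -map_trmx mulmxA. Qed.

(** Multiplying the matrix that defines [T] by [ZtoC R P] yields the invertible Gram matrix of M, so
    its rank is at least 19 and its kernel has dimension at most 22 - 19. *)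
Lemma rank_transc : (\rank T <= 3)%N.
Proof.
rewrite mxrank_ker leq_subLR.
apply: (@leq_trans (19 + 3)) => //; rewrite leq_add2r.
have := mxrankM_maxr (ZtoC R P) (ZtoC R K3_gram *m (ZtoC R P)^T).
by rewrite ZtoC_isometric mxrank_unit ?unit_M_gram.
Qed.

(** [T] is cut out by equations with integer coefficients, which conjugation fixes. *)
Lemma transc_conj x : (x <= T)%MS -> (conj_mx x <= T)%MS.
Proof.
move=> /sub_kermxP h; apply/sub_kermxP.
have := congr1 (@conj_mx R _ _) h; rewrite !conj_mxM conj_ZtoC.
rewrite {2}/conj_mx map_trmx -/(conj_mx _) conj_ZtoC => ->.
by rewrite /conj_mx map_mx0.
Qed.

(* The Gram matrix of M is invertible over C, so every vector is the sum of one in T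
   and one in the span of P. *)
Lemma transc_nondegenerate x :
  (x <= T)%MS -> (forall y, (y <= T)%MS -> cup x y = 0) -> x = 0.
Proof.
move=> /sub_kermxP xT h; apply: cup_nondegenerate => v.
pose c := v *m (ZtoC R K3_gram *m (ZtoC R P)^T) *m invmx (ZtoC R (M_gram n)).
have v'T : (v - c *m ZtoC R P <= T)%MS.
  apply/sub_kermxP; rewrite mulmxBl -[c *m _ *m _]mulmxA ZtoC_isometric.
  by rewrite mulmxKV ?subrr // unit_M_gram.
rewrite -(subrK (c *m ZtoC R P) v) cupDr h // add0r /cup trmx_mul mulmxA.
by rewrite -[_ *m _ *m (ZtoC R P)^T]mulmxA xT mul0mx mxE.
Qed.

(** Here [s1] and [s2] stand for s' and s''. The hypothesis that [s1] is no multiple of [s] makes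
    [s], [s1], [conj_mx s] independent, hence a basis of [T]; all three conclusions are read off
    from expansions in it. *)
Lemma period_relations (s s1 s2 : 'rV[C]_22) :
  [/\ (s <= T)%MS, (s1 <= T)%MS & (s2 <= T)%MS] ->
  cup s s = 0 -> cup s s1 = 0 -> cup s1 s1 + cup s s2 = 0 ->
  cup s (conj_mx s) != 0 -> (forall c, s1 != c *: s) ->
  [/\ cup s s2 != 0,
      cup s1 (conj_mx s) * cup s (conj_mx s1)
        - cup s1 (conj_mx s1) * cup s (conj_mx s) != 0
    & exists al be ga, s2 = al *: s + be *: s1 + ga *: conj_mx s].
Proof.
move=> [sT s1T s2T] c00 c01 c11 F0 nopar.
(* Pairing with [s] kills the first two terms and gives [c = 0]; then [nopar] gives [b = 0], and
   pairing with [conj_mx s] gives [a = 0]. *)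
have free a b c : a *: s + b *: s1 + c *: conj_mx s = 0 -> [/\ a = 0, b = 0 & c = 0].
  move=> e; have c0 : c = 0.
    have := congr1 (cup s) e; rewrite !cupDr !cupZr c00 c01 !mulr0 !add0r.
    rewrite [cup s 0]cupC cup0l => /eqP; rewrite mulf_eq0 (negPf F0) orbF => /eqP //.
  move: e; rewrite c0 scale0r addr0 => e.
  have b0 : b = 0.
    apply/eqP; apply: contraT => bn; have := nopar (- (b^-1 * a)).
    rewrite -[s1 in X in X -> _]scale1r -(mulVf bn) -scalerA.
    by rewrite -(addr0_eq e) scalerN scalerA scaleNr eqxx.
  split=> //; move: e; rewrite b0 scale0r addr0 => e.
  have := congr1 (fun v => cup v (conj_mx s)) e; rewrite cupZl cup0l => /eqP.
  by rewrite mulf_eq0 (negPf F0) orbF => /eqP.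
have span w (wT : (w <= T)%MS) :
    exists a b c, w = a *: s + b *: s1 + c *: conj_mx s.
  by apply: (rank3_span rank_transc) free; split=> //; exact: transc_conj.
have csb : cup (conj_mx s) (conj_mx s) = 0 by rewrite cup_conj c00 rmorph0.
have csb1 : cup (conj_mx s) (conj_mx s1) = 0 by rewrite cup_conj c01 rmorph0.
have s1s1 : cup s1 s1 = - cup s s2 by apply/eqP; rewrite -addr_eq0 c11.
have Y0 : cup s s2 != 0.
  apply/eqP => Y0; have s1s10 : cup s1 s1 = 0 by rewrite s1s1 Y0 oppr0.
  (* If the Yukawa coupling vanished, [s1 - k *: s] would be orthogonal to [s], to [s1] and, by this
     choice of [k], to [conj_mx s]. Nondegeneracy on [T] would make it zero, against [nopar]. *)
  pose k := cup s1 (conj_mx s) / cup s (conj_mx s).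
  have : s1 + (- k) *: s = 0.
    apply: transc_nondegenerate; first by rewrite addmx_sub ?scalemx_sub.
    move=> y /span[a [b [c ->]]]; rewrite !cupDr !cupZr !cupDl !cupZl.
    rewrite [cup s1 s]cupC c00 c01 s1s10 !(mulr0, add0r, addr0).
    by rewrite mulNr divfK // subrr mulr0.
  by move=> /eqP; rewrite scaleNr subr_eq0 => /eqP e; have := nopar k; rewrite {1}e eqxx.
have [al [be [ga e2]]] := span _ s2T.
have [a [b [c e1]]] := span _ (transc_conj s1T).
split=> //; last by exists al, be, ga.
have h1 : cup s (conj_mx s1) = c * cup s (conj_mx s).
  by rewrite e1 !cupDr !cupZr c00 c01 !mulr0 !add0r.
have h2 : cup s1 (conj_mx s1) = - b * cup s s2 + c * cup s1 (conj_mx s).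
  by rewrite e1 !cupDr !cupZr [cup s1 s]cupC c01 s1s1 mulr0 add0r mulrN mulNr.
rewrite (gram4_aux 0 h1 h2) !mulf_neq0 //.
(* If [b = 0], orthogonality of [conj_mx s] and [conj_mx s1] gives [a = 0]. Then [conj_mx s1] is a
   multiple of [conj_mx s], and conjugating contradicts [nopar]. *)
apply/eqP => b0; have h3 : a * cup s (conj_mx s) = 0.
  have := csb1; rewrite e1 b0 !cupDr !cupZr csb mul0r mulr0 !addr0.
  by rewrite cupC.
have a0 : a = 0 by move/eqP: h3; rewrite mulf_eq0 (negPf F0) orbF => /eqP.
have := congr1 (@conj_mx R _ _) e1; rewrite a0 b0 !scale0r !add0r conj_mxK => e3.
have := nopar c^*%C; rewrite e3 => /eqP; apply.
by apply/matrixP => i j; rewrite !mxE; exact: conjcMK.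
Qed.
End CupProduct.

(** * Hodge structures of the family *)

Lemma capmx0_rank (F : fieldType) n (A B : 'M[F]_n) :
  row_full (A + B)%MS -> (\rank A + \rank B <= n)%N -> (A :&: B = 0)%MS.
Proof.
move=> /eqP rAB le; apply/eqP; rewrite -mxrank_eq0 -leqn0.
by have := mxrank_sum_cap A B; rewrite rAB => e; rewrite -(leq_add2l n) e addn0.
Qed.

(** The third hypothesis is the derivative of the minor in the second, with s' = c s substituted and
    [p] = phi' coming from the chain rule. Subtracting [c] times the minor leaves only the
    derivatives [dj], [dk] of the frame. *)
Lemma minor_derivative_aux (F : fieldType) (c p sj sk aj ak dj dk : F) :
  p != 0 -> sj * ak - sk * aj = 0 ->
  c * sj * ak + sj * (dk * p) - (c * sk * aj + sk * (dj * p)) = 0 ->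
  sj * dk = sk * dj.
Proof.
move=> p0 m0 m1; apply: (mulIf p0); apply/eqP; rewrite -subr_eq0; apply/eqP.
have -> : sj * dk * p - sk * dj * p = c * sj * ak + sj * (dk * p)
    - (c * sk * aj + sk * (dj * p)) - c * (sj * ak - sk * aj) by ring.
by rewrite m0 m1 mulr0 subr0.
Qed.

Section Family.
Variables (R : realType) (n : nat) (X : K3_family R n).
Local Notation C := R[i].

(** The Weil operator is ['i ^+ 2] = -1 on type (2,0), which cancels the sign in [polQ]. *)
Lemma hodge_metric_H20 (i : idx X) (t : C) (x y : 'rV[C]_22) :
  dom i t -> (x <= H20 i t)%MS -> hodge_metric i t x y = cup x (conj_mx y).
Proof.
move=> it xH; have full := Hodge_decomposition it.
have r20 := h20 it; have r11 := h11 it; have r02 := h02 it.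
have le2 (A B : 'M[C]_22) : (\rank (A + B) <= \rank A + \rank B)%N.
  exact: (mxrank_adds_leqif A B).1.
(* The Hodge pieces span and their ranks 1, 20, 1 add up to 22, so the sum is direct; this is what
   lets [proj_mx] act as a projection. *)
have cap1 : (H20 i t :&: (H11 i t + H02 i t) = 0)%MS.
  apply: capmx0_rank; first by rewrite addsmxA.
  by rewrite r20 (leq_trans (leq_add (leqnn 1) (le2 _ _))) // r11 r02.
have cap2 : (H11 i t :&: (H20 i t + H02 i t) = 0)%MS.
  apply: capmx0_rank; first by rewrite addsmxA [(H11 i t + _)%MS]addsmxC.
  by rewrite r11 (leq_trans (leq_add (leqnn 20) (le2 _ _))) // r20 r02.
have cap3 : (H02 i t :&: (H20 i t + H11 i t) = 0)%MS.
  apply: capmx0_rank; first by rewrite addsmxC.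
  by rewrite r02 (leq_trans (leq_add (leqnn 1) (le2 _ _))) // r20 r11.
rewrite /hodge_metric /polQ /weil (proj_mx_id cap1 xH).
rewrite (proj_mx_0 cap2 (submx_trans xH (addsmxSl _ _))).
rewrite (proj_mx_0 cap3 (submx_trans xH (addsmxSl _ _))).
by rewrite !scaler0 !addr0 sqr_i scaleN1r cupNl opprK.
Qed.

(** In a flat marking the polarization is locally constant, so near [u] the space is cut out by the
    fixed equations [s w *m M = 0], and these may be differentiated. *)
Lemma transc_derive (i : idx X) (phi : C -> C) (s : C -> 'rV[C]_22) u :
  derivable phi u 1 -> derivable s u 1 -> dom i (phi u) ->
  (\forall w \near u, (s w <= transc i (phi w))%MS) ->
  (derive1 s u <= transc i (phi u))%MS.
Proof.
move=> dphi ds iu sT.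
pose M := ZtoC R K3_gram *m (ZtoC R (pol i (phi u)))^T.
have polc : \forall w \near u, pol i (phi w) = pol i (phi u).
  exact: (derivable_cvg dphi (pol_const iu)).
have sM : \forall w \near u, s w *m M = 0.
  apply: filterS2 sT polc => w /sub_kermxP h e.
  by rewrite /M -e.
apply/sub_kermxP/rowP => j; rewrite [RHS]mxE -/M.
rewrite -(has_wirt_dz (has_vwirt_mulmx M (holomorphic_vwirt ds) j)).
apply: (@has_wirt_dz _ _ _ _ 0); apply: has_wirt_near (has_wirt_cst 0 u).
by apply: filterS sM => w ->; rewrite mxE.
Qed.

(* [s] and the pullback [A \o phi] of a holomorphic frame of F^2 have vanishing
   2x2 minors; differentiating these, [s' = c s] would make [A'] a multiple of
   [A] and the Kodaira-Spencer map of [complete] zero. *)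
Lemma frame_not_parallel (i : idx X) (phi : C -> C) (s : C -> 'rV[C]_22) u c :
  complete X -> derivable phi u 1 -> derive1 phi u != 0 -> derivable s u 1 ->
  dom i (phi u) -> (\forall w \near u, (s w <= H20 i (phi w))%MS) -> s u != 0 ->
  derive1 s u != c *: s u.
Proof.
move=> cX dphi phi0 ds iu sH su0; apply/eqP => par.
have [V [A [openV Vu VD holA frA]]] := F2_holomorphic iu.
have AV w : V w -> (A w <= H20 i w)%MS /\ A w != 0.
  move=> /frA /andP[fA /andP[AH _]]; split=> //; apply: contraTneq fA => ->.
  by rewrite /row_free mxrank0.
have nearV : \forall w \near u, V (phi w).
  exact: (derivable_cvg dphi (open_nbhs_nbhs (conj openV Vu))).
have minor j k : \forall w \near u, s w 0 j * A (phi w) 0 k - s w 0 k * A (phi w) 0 j = 0.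
  apply: filterS2 sH nearV => w sw /frA /andP[_ /andP[_ HA]].
  have /submxP[d ->] := submx_trans sw HA.
  by rewrite [d]mx11_scalar mul_scalar_mx !mxE; ring.
have dA := holA _ Vu.
have wA k := has_wirt_comp (@derivable_coord _ _ _ _ k dA) (holomorphic_wirt dphi).
have ws k := holomorphic_vwirt ds k.
have key j k : s u 0 j * derive1 A (phi u) 0 k = s u 0 k * derive1 A (phi u) 0 j.
  apply: (minor_derivative_aux (c := c) phi0 (nbhs_singleton (minor j k))).
  have := has_wirtD (has_wirtM (ws j) (wA k)) (has_wirtN (has_wirtM (ws k) (wA j))).
  move=> /has_wirt_dz.
  rewrite (@has_wirt_dz _ _ _ 0 0); last first.
    apply: has_wirt_near (has_wirt_cst 0 u).
    by apply: filterS (minor j k) => w ->.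
  by rewrite par ![(c *: s u) 0 _]mxE => <-.
have [j sj] : exists j, s u 0 j != 0.
  apply/existsP; apply: contraT; rewrite negb_exists => /forallP h.
  case/eqP: su0; apply/rowP => j; rewrite mxE; apply/eqP.
  by have := h j; rewrite negbK.
have Apar : derive1 A (phi u) = (derive1 A (phi u) 0 j / s u 0 j) *: s u.
  apply/rowP => k; rewrite [RHS]mxE; apply: (mulfI sj).
  by rewrite key -[in RHS]mulrA [RHS]mulrCA mulVKf // mulrC.
(* For the class 0, both [v = 0] and [v = 1] are solutions, the latter because [Apar] puts the
   derivative of [A] into [H20]. This contradicts uniqueness. *)
have [v [_ uniq]] := cX i V A (phi u) openV VD holA AV Vu 0 (sub0mx _ _).
have e0 : v = 0 by apply: uniq; rewrite scale0r subr0 sub0mx.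
have e1 : v = 1.
  apply: uniq; rewrite scale1r sub0r eqmx_opp Apar scalemx_sub //.
  exact: submx_trans (nbhs_singleton sH) (addsmxSl _ _).
by move/eqP: e1; rewrite e0 eq_sym oner_eq0.
Qed.
End Family.

(** * Picard-Fuchs relations *)

Section FieldIdentities.
Variable F : fieldType.
Hypotheses (n2 : (2 : F) != 0) (n3 : (3 : F) != 0).
Implicit Types h a b y z : F.

(** From here on [cij] stands for B(s^(i), s^(j)), [aij] for the pairing of s^(i) with the conjugate
    of s^(j), [y] for the Yukawa coupling and [z] for B(s'',s''). The last hypothesis is the
    derivative of B(s',s') = - Y, which gives [3 * c12 = - c03]. *)
Lemma cup12_aux h b1 b2 b0 y c12 c03 :
  h != 0 -> h ^+ 3 * c03 = - (b2 * h ^+ 2) * y - b1 * h * 0 - b0 * 0 ->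
  c12 + c12 = - (c12 + c03) -> c12 = b2 / (3 * h) * y.
Proof.
move=> h0 e1 e2; have c03E : c03 = - (b2 / h) * y.
  by apply: (mulfI (expf_neq0 3 h0)); rewrite e1; field.
have e3 : 3 * c12 = - c03 by rewrite -[c03](addKr c12) -[c12 + c03]opprK -e2; ring.
by apply: (mulfI n3); rewrite e3 c03E; field; rewrite n3 h0.
Qed.

(** The last hypothesis is the derivative of [c12 = b2 / (3 * h) * y], with [c12 + c03] as the
    derivative of [y]. *)
Lemma cup22_aux h b1 b2 b0 db2 y z c12 c03 c13 :
  h != 0 -> h ^+ 3 * c03 = - (b2 * h ^+ 2) * y - b1 * h * 0 - b0 * 0 ->
  h ^+ 3 * c13 = - (b2 * h ^+ 2) * c12 - b1 * h * - y - b0 * 0 ->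
  c12 = b2 / (3 * h) * y ->
  z + c13 = db2 / (3 * h) * y + b2 / (3 * h) * (c12 + c03) ->
  z = y * (db2 / (3 * h) + (b2 / (3 * h)) ^+ 2 - b1 / h ^+ 2).
Proof.
move=> h0 e1 e2 e3 e4.
have c03E : c03 = - (b2 / h) * y.
  by apply: (mulfI (expf_neq0 3 h0)); rewrite e1; field.
have c13E : c13 = - (b2 / h) * c12 + b1 / h ^+ 2 * y.
  by apply: (mulfI (expf_neq0 3 h0)); rewrite e2; field.
by rewrite -[z](addrK c13) e4 c13E c03E e3; field; rewrite n3 h0.
Qed.

Lemma connection_coefficient_aux h b2 y a00 a10 be ga c12 :
  h != 0 -> y != 0 -> a00 != 0 -> c12 = b2 / (3 * h) * y ->
  y = ga * a00 -> c12 = - be * y + ga * a10 -> be = a10 / a00 - b2 / (3 * h).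
Proof.
move=> h0 y0 a0 e1 e2 e3; have gaE : ga = y / a00 by rewrite e2 mulfK.
apply: (mulIf y0); have -> : be * y = ga * a10 - c12 by rewrite e3; ring.
by rewrite gaE e1; field; rewrite n3 h0 a0.
Qed.

(** The metric is N / a00^2 with N = [a10 * a01 - a11 * a00]. The terms in [al] cancel in its
    derivative, leaving N' = be N, so Gamma = be - 2 a10 / a00, while K_u = - a10 / a00. *)
Lemma christoffel_aux h b2 a00 a10 a01 a11 a20 a21 al be :
  h != 0 -> a00 != 0 -> a10 * a01 - a11 * a00 != 0 ->
  a20 = al * a00 + be * a10 -> a21 = al * a01 + be * a11 ->
  be = a10 / a00 - b2 / (3 * h) ->
  ((a10 * a01 - a11 * a00) * (a00^-1 * a00^-1))^-1 *
   ((a20 * a01 + a10 * a11 - (a21 * a00 + a11 * a10)) * (a00^-1 * a00^-1) +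
    (a10 * a01 - a11 * a00) *
     (- (a10 / a00 ^+ 2) * a00^-1 + a00^-1 * - (a10 / a00 ^+ 2))) -
  - (a10 * a00^-1) = - (3 * h)^-1 * b2.
Proof.
move=> h0 a0 N0 e1 e2 e3.
have e4 : a20 * a01 + a10 * a11 - (a21 * a00 + a11 * a10) = be * (a10 * a01 - a11 * a00).
  by rewrite e1 e2; ring.
rewrite e4 e3; move: (a10 * a01 - a11 * a00) N0 => N N0.
by field; rewrite n3 h0 a0 N0.
Qed.

Lemma curvature_aux h b1 b2 db2 y z a00 a10 a20 al be ga c12 :
  h != 0 -> y != 0 -> a00 != 0 -> c12 = b2 / (3 * h) * y ->
  y = ga * a00 -> be = a10 / a00 - b2 / (3 * h) ->
  a20 = al * a00 + be * a10 ->
  z = al * y + be * c12 + ga * a20 ->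
  z = y * (db2 / (3 * h) + (b2 / (3 * h)) ^+ 2 - b1 / h ^+ 2) ->
  - (a20 * a00^-1 + a10 * - (a10 / a00 ^+ 2)) =
    2^-1 * (- (a10 * a00^-1)) ^+ 2 - (3 * h)^-1 * b2 * - (a10 * a00^-1)
    - (9 * h ^+ 2)^-1 * b2 ^+ 2 - (6 * h)^-1 * db2 + (2 * h ^+ 2)^-1 * b1.
Proof.
move=> h0 y0 a0 e1 e2 e3 e4 e5 e6.
have gaE : ga = y / a00 by rewrite e2 mulfK.
have n9 : (9 : F) != 0 by rewrite (_ : 9 = 3 * 3) ?mulf_neq0 //; ring.
have n6 : (6 : F) != 0 by rewrite (_ : 6 = 2 * 3) ?mulf_neq0 //; ring.
pose X := db2 / (3 * h) + (b2 / (3 * h)) ^+ 2 - b1 / h ^+ 2.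
(* [al] enters the expansion of [z] twice, directly and through [a20], hence the factor 1/2. *)
have alE : al = 2^-1 * (X - be * (b2 / (3 * h)) - be * (a10 / a00)).
  apply: (mulfI n2); rewrite mulVKf //; apply: (mulIf y0).
  have -> : X - be * (b2 / (3 * h)) - be * (a10 / a00) =
      (z - be * c12 - be * (a10 / a00) * y) / y.
    by rewrite e6 e1 -/X; field; rewrite n3 h0 a0 y0.
  by rewrite divfK // e5 gaE e4 e1; field; rewrite n3 h0 a0.
by rewrite e4 alE e3 /X; field; rewrite ?n2 ?n3 ?n6 ?n9 ?h0 ?a0.
Qed.

(** With p = b2 / (3 h), the last hypothesis is the derivative of p' = z / y - p^2 + b1 / h^2, where
    z' = 2 c23. *)
Lemma third_order_aux h b0 b1 b2 db1 db2 ddb2 y z c12 c03 c23 :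
  h != 0 -> y != 0 ->
  c12 = b2 / (3 * h) * y ->
  z = y * (db2 / (3 * h) + (b2 / (3 * h)) ^+ 2 - b1 / h ^+ 2) ->
  h ^+ 3 * c03 = - (b2 * h ^+ 2) * y - b1 * h * 0 - b0 * 0 ->
  h ^+ 3 * c23 = - (b2 * h ^+ 2) * z - b1 * h * c12 - b0 * y ->
  ddb2 / (3 * h) = (c23 + c23) * y^-1 + z * - ((c12 + c03) / y ^+ 2)
    - 2 * (b2 / (3 * h)) * (db2 / (3 * h)) + db1 / h ^+ 2 ->
  h ^+ 2 * ddb2 + 2 * b2 * h * db2 - 3 * h * db1 + 4 / 9 * b2 ^+ 3
    - 2 * b1 * b2 + 6 * b0 = 0.
Proof.
move=> h0 y0 e1 e2 e3 e4 e5.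
have n9 : (9 : F) != 0 by rewrite (_ : 9 = 3 * 3) ?mulf_neq0 //; ring.
have c03E : c03 = - (b2 / h) * y.
  by apply: (mulfI (expf_neq0 3 h0)); rewrite e3; field.
have c23E : c23 = - (b2 / h) * z - b1 / h ^+ 2 * c12 - b0 / h ^+ 3 * y.
  by apply: (mulfI (expf_neq0 3 h0)); rewrite e4; field.
have -> : ddb2 = 3 * h * (ddb2 / (3 * h)) by rewrite mulrC divfK // mulf_neq0.
by rewrite e5 c23E c03E e2 e1; field; rewrite ?n3 ?n9 ?h0 ?y0.
Qed.

Lemma p_derivative_aux h b1 b2 db2 y : h != 0 -> y != 0 ->
  3 * h * (y * (db2 / (3 * h) + (b2 / (3 * h)) ^+ 2 - b1 / h ^+ 2) * y^-1
    + - (b2 / (3 * h) * (b2 / (3 * h))) + b1 / h ^+ 2) = db2.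
Proof. by move=> h0 y0; field; rewrite n3 h0 y0. Qed.

Lemma ddb2_aux h b1 b2 db1 db2 z z' y y' f : h != 0 ->
  (0 * f +
    3 * h * (z' * y^-1 + z * - (y' / y ^+ 2)
     + - (db2 / (3 * h) * (b2 / (3 * h)) + b2 / (3 * h) * (db2 / (3 * h)))
     + (db1 / h ^+ 2 + b1 * 0))) / (3 * h) =
  z' * y^-1 + z * - (y' / y ^+ 2)
    - 2 * (b2 / (3 * h)) * (db2 / (3 * h)) + db1 / h ^+ 2.
Proof.
move=> h0; rewrite mul0r mulr0 addr0 add0r [3 * h * _]mulrC mulfK ?mulf_neq0 //.
by ring.
Qed.

Lemma metric_aux a00 a10 a01 a11 : a00 != 0 ->
  (a10 * a01 - a11 * a00) * (a00^-1 * a00^-1) =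
  - (a11 * a00^-1 + a01 * - (a10 / a00 ^+ 2)).
Proof. by move=> a0; field. Qed.
End FieldIdentities.

(** * Differentiating the period pairings in one flat marking *)

Section Period.
Variable R : realType.
Local Notation C := R[i].

Lemma cup0r (x : 'rV[C]_22) : cup x 0 = 0.
Proof. by rewrite cupC cup0l. Qed.

Lemma cupNr (x y : 'rV[C]_22) : cup x (- y) = - cup x y.
Proof. by rewrite cupC cupNl cupC. Qed.

Lemma has_wirt_cup_holomorphic (x y : C -> 'rV[C]_22) z (x' y' : 'rV[C]_22) :
  has_vwirt x z x' 0 -> has_vwirt y z y' 0 ->
  has_wirt (fun w => cup (x w) (y w)) z (cup x' (y z) + cup (x z) y') 0.
Proof. by move=> dx dy; have := has_wirt_cup dx dy; rewrite cup0l cup0r addr0. Qed.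

Lemma has_wirt_cup_conj (x y : C -> 'rV[C]_22) z (x' y' : 'rV[C]_22) :
  has_vwirt x z x' 0 -> has_vwirt y z y' 0 ->
  has_wirt (fun w => cup (x w) (conj_mx (y w))) z
    (cup x' (conj_mx (y z))) (cup (x z) (conj_mx y')).
Proof.
move=> dx dy; have := has_wirt_cup dx (has_vwirt_conj dy).
by rewrite [conj_mx 0]map_mx0 cup0l cup0r addr0 add0r.
Qed.

Lemma has_wirt_eq_open (U : set C) (f g : C -> C) z a b : open U -> U z ->
  (forall w, U w -> f w = g w) -> has_wirt f z a b -> has_wirt g z a b.
Proof.
move=> oU Uz fg; apply: has_wirt_near.
by apply: filterS (open_nbhs_nbhs (conj oU Uz)) => w /fg.
Qed.

Variables (U : set C) (s0 s1 s2 s3 : C -> 'rV[C]_22).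
Hypothesis U_open : open U.
Hypothesis d0 : forall w, U w -> has_vwirt s0 w (s1 w) 0.
Hypothesis d1 : forall w, U w -> has_vwirt s1 w (s2 w) 0.
Hypothesis d2 : forall w, U w -> has_vwirt s2 w (s3 w) 0.
Hypothesis isotropic : forall w, U w -> cup (s0 w) (s0 w) = 0.

Lemma cup01 w : U w -> cup (s0 w) (s1 w) = 0.
Proof.
move=> Uw; have h := has_wirt_cup_holomorphic (d0 Uw) (d0 Uw).
(* The Leibniz derivative is compared with that of a function equal to the pairing on all of [U],
   here the constant 0. [cup11], [cup12] and [cup22] repeat this, each differentiating an earlier
   relation. *)
have [e _] := has_wirt_unique h (has_wirt_eq_open U_open Uw
  (fun w Uw => esym (isotropic Uw)) (has_wirt_cst 0 w)).
move: e; rewrite [cup (s1 w) _]cupC -mulr2n => /eqP.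
by rewrite mulrn_eq0 => /eqP.
Qed.

Lemma cup11 w : U w -> cup (s1 w) (s1 w) + cup (s0 w) (s2 w) = 0.
Proof.
move=> Uw; have h := has_wirt_cup_holomorphic (d0 Uw) (d1 Uw).
by have [e _] := has_wirt_unique h (has_wirt_eq_open U_open Uw
  (fun w Uw => esym (cup01 Uw)) (has_wirt_cst 0 w)).
Qed.

Variables (hbar : C) (b0 b1 b2 : C -> C) (K : C -> R).
Hypothesis hbar0 : hbar != 0.
Hypotheses (db1 : holomorphic_on U b1) (db2 : holomorphic_on U b2).
Hypothesis PF : forall w, U w -> hbar ^+ 3 *: s3 w =
  - (b2 w * hbar ^+ 2) *: s2 w - (b1 w * hbar) *: s1 w - b0 w *: s0 w.
Hypothesis KE : forall w, U w -> (expR (- K w))%:C = cup (s0 w) (conj_mx (s0 w)).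
Hypothesis y_neq0 : forall w, U w -> cup (s0 w) (s2 w) != 0.
Hypothesis N_neq0 : forall w, U w ->
  cup (s1 w) (conj_mx (s0 w)) * cup (s0 w) (conj_mx (s1 w))
    - cup (s1 w) (conj_mx (s1 w)) * cup (s0 w) (conj_mx (s0 w)) != 0.
Hypothesis frame : forall w, U w ->
  exists al be ga, s2 w = al *: s0 w + be *: s1 w + ga *: conj_mx (s0 w).

Let a00 w := cup (s0 w) (conj_mx (s0 w)).
Let a10 w := cup (s1 w) (conj_mx (s0 w)).
Let a01 w := cup (s0 w) (conj_mx (s1 w)).
Let a11 w := cup (s1 w) (conj_mx (s1 w)).
Let y w := cup (s0 w) (s2 w).

Let n2 : (2 : C) != 0. Proof. by rewrite pnatr_eq0. Qed.
Let n3 : (3 : C) != 0. Proof. by rewrite pnatr_eq0. Qed.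

Lemma PF_cup x w : U w -> hbar ^+ 3 * cup x (s3 w) =
  - (b2 w * hbar ^+ 2) * cup x (s2 w) - b1 w * hbar * cup x (s1 w) - b0 w * cup x (s0 w).
Proof.
move=> Uw; have := congr1 (cup x) (PF Uw); rewrite !cupDr !cupNr !cupZr.
exact.
Qed.

Lemma cup11E w : U w -> cup (s1 w) (s1 w) = - y w.
Proof. by move=> Uw; apply/eqP; rewrite -addr_eq0 cup11. Qed.

Lemma PF_cup0 w : U w -> hbar ^+ 3 * cup (s0 w) (s3 w) =
  - (b2 w * hbar ^+ 2) * y w - b1 w * hbar * 0 - b0 w * 0.
Proof. by move=> Uw; rewrite PF_cup // cup01 // isotropic. Qed.

Lemma has_wirt_y w : U w ->
  has_wirt y w (cup (s1 w) (s2 w) + cup (s0 w) (s3 w)) 0.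
Proof. by move=> Uw; exact: (has_wirt_cup_holomorphic (d0 Uw) (d2 Uw)). Qed.

Lemma cup12 w : U w -> cup (s1 w) (s2 w) = b2 w / (3 * hbar) * y w.
Proof.
move=> Uw; apply: (cup12_aux n3 hbar0 (PF_cup0 Uw)).
have h := has_wirt_cup_holomorphic (d1 Uw) (d1 Uw).
have [e _] := has_wirt_unique h (has_wirt_eq_open U_open Uw
  (fun w Uw => esym (cup11E Uw)) (has_wirtN (has_wirt_y Uw))).
by move: e; rewrite [cup (s2 w) _]cupC.
Qed.

Lemma has_wirt_p w : U w ->
  has_wirt (fun v => b2 v / (3 * hbar)) w (dz b2 w / (3 * hbar)) 0.
Proof.
move=> Uw; have h := holomorphic_wirt (db2 Uw).
have := has_wirtM h (has_wirt_cst (3 * hbar)^-1 w).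
by rewrite (has_wirt_dz h) mulr0 mul0r !addr0.
Qed.

Lemma cup22 w : U w -> cup (s2 w) (s2 w) =
  y w * (dz b2 w / (3 * hbar) + (b2 w / (3 * hbar)) ^+ 2 - b1 w / hbar ^+ 2).
Proof.
move=> Uw; have e13 : hbar ^+ 3 * cup (s1 w) (s3 w) =
    - (b2 w * hbar ^+ 2) * cup (s1 w) (s2 w) - b1 w * hbar * - y w - b0 w * 0.
  by rewrite PF_cup // cup11E // [cup (s1 w) (s0 w)]cupC cup01.
apply: (cup22_aux n3 hbar0 (PF_cup0 Uw) e13 (cup12 Uw)).
have h := has_wirt_cup_holomorphic (d1 Uw) (d2 Uw).
by have [e _] := has_wirt_unique h (has_wirt_eq_open U_open Uw
  (fun w Uw => esym (cup12 Uw)) (has_wirtM (has_wirt_p Uw) (has_wirt_y Uw))).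
Qed.

Lemma b_relation w : U w ->
  hbar ^+ 2 * dz (dz b2) w + 2 * b2 w * hbar * dz b2 w
    - 3 * hbar * dz b1 w + 4 / 9 * b2 w ^+ 3 - 2 * b1 w * b2 w + 6 * b0 w = 0.
Proof.
move=> Uw.
have e23 : hbar ^+ 3 * cup (s2 w) (s3 w) = - (b2 w * hbar ^+ 2) * cup (s2 w) (s2 w)
    - b1 w * hbar * cup (s1 w) (s2 w) - b0 w * y w.
  by rewrite PF_cup // [cup (s2 w) (s1 w)]cupC [cup (s2 w) (s0 w)]cupC.
apply: (third_order_aux n3 hbar0 (y_neq0 Uw) (cup12 Uw) (cup22 Uw) (PF_cup0 Uw) e23).
have hz := has_wirt_cup_holomorphic (d2 Uw) (d2 Uw).
have hq := has_wirtM (holomorphic_wirt (db1 Uw)) (has_wirt_cst (hbar ^+ 2)^-1 w).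
have hp := has_wirt_p Uw.
have := has_wirtD (has_wirtD (has_wirtM hz (has_wirtV (y_neq0 Uw) (has_wirt_y Uw)))
  (has_wirtN (has_wirtM hp hp))) hq.
(* Solving [cup22] for [dz b2] exhibits it as a differentiable function. *)
set f := (X in has_wirt X) => hf.
have fE v : U v -> 3 * hbar * f v = dz b2 v.
  move=> Uv; rewrite /f cup22 //; exact: (p_derivative_aux n3 _ _ _ hbar0 (y_neq0 Uv)).
have h := has_wirt_eq_open U_open Uw fE (has_wirtM (has_wirt_cst (3 * hbar) w) hf).
rewrite (has_wirt_dz h) (has_wirt_dz (holomorphic_wirt (db1 Uw))).
rewrite [cup (s3 w) (s2 w)]cupC; exact: (ddb2_aux n3 _ _ _ _ _ _ _ _ _ hbar0).
Qed.

Lemma has_wirt_K w : U w ->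
  has_wirt (fun v => (K v)%:C) w (- (a10 w / a00 w)) (- (a01 w / a00 w)).
Proof.
move=> Uw; apply: has_wirt_log (has_wirt_cup_conj (d0 Uw) (d0 Uw)).
by apply: filterS (open_nbhs_nbhs (conj U_open Uw)) => v /KE.
Qed.

Lemma a00_neq0 w : U w -> a00 w != 0.
Proof.
move=> Uw; rewrite /a00 -KE // -[0](rmorph0 (real_complex R)) (inj_eq (@complexI R)).
by rewrite gt_eqF ?expR_gt0.
Qed.

Lemma dz_Ku w : U w -> dz (dz (fun v => (K v)%:C)) w =
  - (cup (s2 w) (conj_mx (s0 w)) * (a00 w)^-1 + a10 w * - (a10 w / a00 w ^+ 2)).
Proof.
move=> Uw; have h00 := has_wirt_cup_conj (d0 Uw) (d0 Uw).
have h10 := has_wirt_cup_conj (d1 Uw) (d0 Uw).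
apply: has_wirt_dz (has_wirt_eq_open U_open Uw _
  (has_wirtN (has_wirtM h10 (has_wirtV (a00_neq0 Uw) h00)))).
by move=> v Uv; rewrite (has_wirt_dz (has_wirt_K Uv)).
Qed.

Lemma metricE w : U w -> dz (dzbar (fun v => (K v)%:C)) w =
  (a10 w * a01 w - a11 w * a00 w) * ((a00 w)^-1 * (a00 w)^-1).
Proof.
move=> Uw; have h00 := has_wirt_cup_conj (d0 Uw) (d0 Uw).
have h01 := has_wirt_cup_conj (d0 Uw) (d1 Uw).
rewrite (metric_aux _ _ _ (a00_neq0 Uw)).
apply: has_wirt_dz (has_wirt_eq_open U_open Uw _
  (has_wirtN (has_wirtM h01 (has_wirtV (a00_neq0 Uw) h00)))).
by move=> v Uv; rewrite (has_wirt_dzbar (has_wirt_K Uv)).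
Qed.

Lemma dz_metric w : U w -> dz (dz (dzbar (fun v => (K v)%:C))) w =
  (cup (s2 w) (conj_mx (s0 w)) * a01 w + a10 w * a11 w
     - (cup (s2 w) (conj_mx (s1 w)) * a00 w + a11 w * a10 w)) * ((a00 w)^-1 * (a00 w)^-1)
  + (a10 w * a01 w - a11 w * a00 w) *
     (- (a10 w / a00 w ^+ 2) * (a00 w)^-1 + (a00 w)^-1 * - (a10 w / a00 w ^+ 2)).
Proof.
move=> Uw; have h00 := has_wirt_cup_conj (d0 Uw) (d0 Uw).
have h01 := has_wirt_cup_conj (d0 Uw) (d1 Uw).
have h10 := has_wirt_cup_conj (d1 Uw) (d0 Uw).
have h11 := has_wirt_cup_conj (d1 Uw) (d1 Uw).
have hV := has_wirtV (a00_neq0 Uw) h00.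
apply: has_wirt_dz (has_wirt_eq_open U_open Uw _
  (has_wirtM (has_wirtD (has_wirtM h10 h01) (has_wirtN (has_wirtM h11 h00)))
    (has_wirtM hV hV))).
by move=> v Uv; rewrite metricE.
Qed.

Lemma period_equations w : U w ->
  let K_u := dz (fun u => (K u)%:C) in
  let G := dz (dzbar (fun u => (K u)%:C)) in
  (G w)^-1 * dz G w - K_u w = - (3 * hbar)^-1 * b2 w /\
  dz K_u w = 2^-1 * K_u w ^+ 2 - (3 * hbar)^-1 * b2 w * K_u w
    - (9 * hbar ^+ 2)^-1 * b2 w ^+ 2 - (6 * hbar)^-1 * dz b2 w
    + (2 * hbar ^+ 2)^-1 * b1 w.
Proof.
move=> Uw K_u G; have [al [be [ga e2]]] := frame Uw.
have csb : cup (conj_mx (s0 w)) (conj_mx (s0 w)) = 0.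
  by rewrite cup_conj isotropic // rmorph0.
have csb1 : cup (conj_mx (s0 w)) (conj_mx (s1 w)) = 0.
  by rewrite cup_conj cup01 // rmorph0.
have e20 : cup (s2 w) (conj_mx (s0 w)) = al * a00 w + be * a10 w.
  by rewrite e2 !cupDl !cupZl csb mulr0 addr0.
have e21 : cup (s2 w) (conj_mx (s1 w)) = al * a01 w + be * a11 w.
  by rewrite e2 !cupDl !cupZl csb1 mulr0 addr0.
have ey : y w = ga * a00 w.
  by rewrite /y e2 !cupDr !cupZr isotropic // cup01 // !mulr0 !add0r.
have e12 : cup (s1 w) (s2 w) = - be * y w + ga * a10 w.
  by rewrite {1}e2 !cupDr !cupZr [cup (s1 w) (s0 w)]cupC cup01 // cup11E //
    mulr0 add0r mulrN mulNr.
have e22 : cup (s2 w) (s2 w) = al * y w + be * cup (s1 w) (s2 w)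
    + ga * cup (s2 w) (conj_mx (s0 w)).
  (* Only the second argument is expanded, so that the pairing of [s2 w] with [conj_mx (s0 w)]
     survives and [e20] can be used on it. *)
  rewrite {2}e2 !cupDr !cupZr.
  by rewrite [cup (s2 w) (s0 w)]cupC [cup (s2 w) (s1 w)]cupC.
have eb := connection_coefficient_aux n3 hbar0 (y_neq0 Uw) (a00_neq0 Uw) (cup12 Uw)
  ey e12.
rewrite /G /K_u dz_metric // metricE // dz_Ku // (has_wirt_dz (has_wirt_K Uw)); split.
  exact: (christoffel_aux n3 hbar0 (a00_neq0 Uw) (N_neq0 Uw) e20 e21 eb).
exact: (curvature_aux n2 n3 hbar0 (y_neq0 Uw) (a00_neq0 Uw) (cup12 Uw) ey eb e20
    e22 (cup22 Uw)).
Qed.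
End Period.

(** * Reduction to one flat marking and conclusion *)

Theorem proposition2p9 (R : realType) (n : nat) (X : K3_family R n)
    (D : set R[i]) (phi : R[i] -> R[i]) (hbar : R[i]) (b0 b1 b2 : R[i] -> R[i])
    (omega : idx X -> R[i] -> 'rV[R[i]]_22) (K : R[i] -> R) :
  (1 <= n)%N ->
  complete X ->
  local_coordinate D phi ->
  hbar != 0 ->
  holomorphic_on D b0 -> holomorphic_on D b1 -> holomorphic_on D b2 ->
  local_frame_L D phi omega ->
  Picard_Fuchs D phi hbar b0 b1 b2 omega ->
  (forall i u, cdom D phi i u ->
     (expR (- K u))%:C = hodge_metric i (phi u) (omega i u) (omega i u)) ->
  let K_u := dz (fun u => (K u)%:C) in
  let G := dz (dzbar (fun u => (K u)%:C)) in
  let Gamma := fun u => (G u)^-1 * dz G u in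
  forall u, D u ->
  [/\ Gamma u - K_u u = - (3 * hbar)^-1 * b2 u,
      dz K_u u = 2^-1 * K_u u ^+ 2 - (3 * hbar)^-1 * b2 u * K_u u
                 - (9 * hbar ^+ 2)^-1 * b2 u ^+ 2
                 - (6 * hbar)^-1 * dz b2 u
                 + (2 * hbar ^+ 2)^-1 * b1 u
    & hbar ^+ 2 * dz (dz b2) u + 2 * b2 u * hbar * dz b2 u
      - 3 * hbar * dz b1 u + 4 / 9 * b2 u ^+ 3 - 2 * b1 u * b2 u + 6 * b0 u = 0].
Proof.
move=> n1 cX [oD hphi phi' _ base_phi] h0 _ hb1 hb2 [_ _ fr] PFall KE K_u G Gamma u Du.
(* The claims involve only [K] and the coefficient functions near [u], which carry no marking, so a
   single marking around [phi u] suffices. *)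
have [i _ iu] : (\bigcup_(i in [set: idx X]) dom i) (phi u).
  by rewrite dom_cover; exact: base_phi.
pose U := cdom D phi i.
have Uu : U u by split.
have UD w : U w -> D w by case.
have Ui w : U w -> dom i (phi w) by case.
have dphi w : U w -> derivable phi w 1 by move=> /UD; exact: hphi.
have oU : open U.
  rewrite openE => w Uw; apply: filterI.
    exact: (open_nbhs_nbhs (conj oD (UD w Uw))).
  exact: (derivable_cvg (dphi w Uw)
    (open_nbhs_nbhs (conj (dom_open (i := i)) (Ui w Uw)))).
have nearU w (P : R[i] -> Prop) : U w -> (forall v, U v -> P v) -> \forall v \near w, P v.
  by move=> Uw UP; apply: filterS (open_nbhs_nbhs (conj oU Uw)).
have [d0 d1 d2 PF] := PFall i.
set s0 := omega i in d0; set s1 := nabla omega i in d1.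
set s2 := nabla (nabla omega) i in d2.
have s0T w : U w -> (s0 w <= transc i (phi w))%MS.
  by move=> /fr[]; rewrite sub_capmx => /andP[].
have s0H w : U w -> (s0 w <= H20 i (phi w))%MS.
  by move=> /fr[]; rewrite sub_capmx => /andP[].
have s1T w : U w -> (s1 w <= transc i (phi w))%MS.
  move=> Uw; exact: (transc_derive (dphi w Uw) (d0 w Uw) (Ui w Uw) (nearU w _ Uw s0T)).
have s2T w : U w -> (s2 w <= transc i (phi w))%MS.
  move=> Uw; exact: (transc_derive (dphi w Uw) (d1 w Uw) (Ui w Uw) (nearU w _ Uw s1T)).
have c00 w : U w -> cup (s0 w) (s0 w) = 0.
  move=> Uw; exact: (cup_20_20 (Ui w Uw) (s0H w Uw) (s0H w Uw)).
have KE0 w : U w -> (expR (- K w))%:C = cup (s0 w) (conj_mx (s0 w)).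
  by move=> Uw; rewrite (KE i w Uw) (hodge_metric_H20 _ (Ui w Uw) (s0H w Uw)).
have v0 w : U w -> has_vwirt s0 w (s1 w) 0.
  by move=> Uw; exact: (holomorphic_vwirt (d0 w Uw)).
have v1 w : U w -> has_vwirt s1 w (s2 w) 0.
  by move=> Uw; exact: (holomorphic_vwirt (d1 w Uw)).
have v2 w : U w -> has_vwirt s2 w (nabla (nabla (nabla omega)) i w) 0.
  by move=> Uw; exact: (holomorphic_vwirt (d2 w Uw)).
(* Completeness enters here, through [frame_not_parallel]; the result holds at every point of [U],
   as the later differentiations require. *)
have rel w (Uw : U w) := period_relations n1 (pol_isometric (Ui w Uw))
  (And3 (s0T w Uw) (s1T w Uw) (s2T w Uw)) (c00 w Uw)
  (cup01 oU v0 c00 Uw) (cup11 oU v0 v1 c00 Uw) (a00_neq0 KE0 Uw)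
  (fun c => frame_not_parallel c cX (dphi w Uw) (phi' w (UD w Uw)) (d0 w Uw) (Ui w Uw)
     (nearU w _ Uw s0H) (fr i w Uw).2).
have y_neq0 w (Uw : U w) : cup (s0 w) (s2 w) != 0 by case: (rel w Uw).
have N_neq0 w (Uw : U w) := let: And3 _ h _ := rel w Uw in h.
have frame w (Uw : U w) := let: And3 _ _ h := rel w Uw in h.
have b1U : holomorphic_on U b1 by move=> w /UD; exact: hb1.
have b2U : holomorphic_on U b2 by move=> w /UD; exact: hb2.
have [e1 e2] := period_equations oU v0 v1 v2 c00 h0 b2U PF KE0 y_neq0 N_neq0 frame Uu.
split; [exact: e1 | exact: e2 |].
exact: (b_relation oU v0 v1 v2 c00 h0 b1U b2U PF y_neq0 Uu).
Qed.
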